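(* Let $\mathrm{ET}=\mathbf{R}^4=\mathbf{R}^3\times\mathbf{R}$ be Minkowski spacetime, with points $X=(r,t)$, equipped with the Poincaré quadratic form $x^2+y^2+z^2-t^2$, where $r=(x,y,z)$. The inertial automorphisms of Einsteinian relativity are the affine maps $$g:X\mapsto LX+C,$$ where $X\in\mathrm{ET}$, $C\in\mathbf{R}^4$, and $L$ is a linear automorphism, a Lorentz transformation. Setting $X=(r,t)\in\mathbf{R}^3\times\mathbf{R}$, any element of the Lorentz group decomposes uniquely as the product of two matrices $$L=\begin{pmatrix}\mathbf{1}_3 & \boldsymbol\beta\\ \bar{\boldsymbol\beta} & 1\end{pmatrix}\begin{pmatrix}B^{-1} & 0\\ 0 & a\end{pmatrix}\quad\text{with}\quad \bar B B+\boldsymbol\beta\bar{\boldsymbol\beta}=\mathbf{1}_3\quad\text{and}\quad a=\pm\frac{1}{\sqrt{1-\beta^2}},$$ where $B$ is a $3\times3$ matrix, $\boldsymbol\beta$ is a vector in $\mathbf{R}^3$, the bar above $B$ or $\boldsymbol\beta$ denotes the transpose, and $\beta=\|\boldsymbol\beta\|$. The projection $L\mapsto\boldsymbol\beta$ is a trivial fibration of the Lorentz group $\mathfrak{L}$ over $\mathbf{R}^3$ with fiber the subgroup $\mathrm{O}(3)\times\{\pm1\}$. The Poincaré group is therefore a six-dimensional group with four connected components.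
   Context: Units are chosen so that the speed of light is $1$; $\mathbf{1}_3$ is the $3\times3$ identity matrix. The inertial motions of Einsteinian mechanics are all the affine lines of spacetime. An inertial automorphism is an automorphism of the spacetime $\mathrm{ET}$ that (a) preserves inertial motions, i.e. transforms any affine line of spacetime into another affine line, and (b) preserves the Poincaré quadratic structure, i.e. the product of two vectors by the quadratic form is unchanged under its action. The group of all inertial automorphisms is called the Poincaré group. A Lorentz transformation is a linear transformation of $\mathbf{R}^4$ that preserves the Poincaré quadratic form, i.e. a $4\times4$ matrix $L$ with $\bar L G L=G$, where $G=\mathrm{diag}(1,1,1,-1)$. The Lorentz group $\mathfrak{L}$ is the group of all Lorentz transformations. The subgroup $\mathrm{O}(3)\times\{\pm1\}$ of $\mathfrak{L}$ consists of the block-diagonal matrices with blocks $A\in\mathrm{O}(3)$ and $\pm1$ (the case $\boldsymbol\beta=0$). It is customary to consider only the identity component of the Poincaré group; the statement concerns the full group.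
   Formalization: The Poincaré group of maps X ↦ LX+C has dimension 10, not six: dimension 6 is proved for the Lorentz group and 6+4 for the Poincaré group; the fibration L ↦ β is over the open unit ball, where β takes its values, which is shown diffeomorphic to R^3. *)

(* Defs.v *)
From HB Require Import structures.
From mathcomp Require Import all_boot all_order all_algebra.
From mathcomp Require Import all_classical all_reals all_analysis.
Set Implicit Arguments.
Unset Strict Implicit.
Unset Printing Implicit Defensive.
Import Order.TTheory GRing.Theory Num.Theory.
Import numFieldNormedType.Exports.
Local Open Scope classical_set_scope.
Local Open Scope ring_scope.

(** * Smooth maps and submanifolds of normed spaces

    All the spaces used below are finite-dimensional (matrices and products of
    matrix spaces), where "C^k on the open set U" amounts to the existence and
    continuity on U of all iterated directional derivatives of order <= k. *)

Fixpoint Ck_open (R : realType) (V W : normedModType R) (k : nat) (U : set V)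
    (f : V -> W) : Prop :=
  (forall x, U x -> {for x, continuous f}) /\
  if k is k'.+1 then
    forall v : V, (forall x, U x -> derivable f x v) /\
                  Ck_open k' U (fun x => 'D_v f x)
  else True.

Definition smooth_open (R : realType) (V W : normedModType R) (U : set V)
    (f : V -> W) : Prop :=
  forall k, Ck_open k U f.

(** A map on an arbitrary subset S is smooth when it extends, near each point
    of S, to a smooth map on an open set of the ambient space. *)
Definition smooth_on (R : realType) (V W : normedModType R) (S : set V)
    (f : V -> W) : Prop :=
  forall x, S x -> exists (U : set V) (F : V -> W),
    [/\ open U, U x, smooth_open U F &
        forall y, S y -> U y -> F y = f y].

Definition diffeomorphism (R : realType) (V W : normedModType R)
    (S : set V) (T : set W) (f : V -> W) : Prop :=
  [/\ set_bij S T f, smooth_on S f &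
      exists g : W -> V, smooth_on T g /\ (forall x, S x -> g (f x) = x)].

Definition submanifold (R : realType) (V : normedModType R) (d : nat)
    (S : set V) : Prop :=
  forall x, S x -> exists (U : set V) (O : set 'rV[R]_d) (f : V -> 'rV[R]_d),
    [/\ open U, U x, open O & diffeomorphism (S `&` U) O f].

(** [p : E -> B] is isomorphic, over B, to the first projection of B * F. *)
Definition trivial_fibration (R : realType) (V W Z : normedModType R)
    (E : set V) (p : V -> W) (B : set W) (F : set Z) : Prop :=
  exists phi : V -> Z,
    diffeomorphism E (B `*` F) (fun x => (p x, phi x)).

Definition components (T : topologicalType) (S : set T) : set (set T) :=
  [set connected_component S x | x in S].

(** * Minkowski spacetime

    A point X = (r, t) of R^3 x R is the column [col_mx r t%:M]. *)

Definition spacetime (R : realType) := 'cV[R]_(3 + 1).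

Definition poincare_form (R : realType) (X : spacetime R) : R :=
  \sum_(i < 3) usubmx X i 0 ^+ 2 - dsubmx X 0 0 ^+ 2.

(** The product of two vectors by the quadratic form, i.e. its polar form. *)
Definition poincare_prod (R : realType) (u v : spacetime R) : R :=
  (poincare_form (u + v) - poincare_form u - poincare_form v) / 2.

Definition affine_line (R : realType) (D : set (spacetime R)) : Prop :=
  exists (P u : spacetime R), u != 0 /\ D = [set P + s *: u | s in [set: R]].

(** A map g acts on a vector u attached at X by u |-> g (X + u) - g X; g is not
    assumed to be affine. *)
Definition inertial_automorphism (R : realType)
    (g : spacetime R -> spacetime R) : Prop :=
  [/\ bijective g,
      forall D, affine_line D -> affine_line (g @` D) &
      forall X u v : spacetime R,
        poincare_prod (g (X + u) - g X) (g (X + v) - g X) = poincare_prod u v].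

Definition poincare_gram (R : realType) : 'M[R]_(3 + 1) :=
  block_mx 1%:M 0 0 (-1)%:M.

Definition lorentz_group (R : realType) : set 'M[R]_(3 + 1) :=
  [set L | L^T *m poincare_gram R *m L = poincare_gram R].
Arguments lorentz_group : clear implicits.

Definition O3_pm1 (R : realType) : set 'M[R]_(3 + 1) :=
  [set M | exists (A : 'M[R]_3) (e : R),
     [/\ A^T *m A = 1%:M, e = 1 \/ e = -1 & M = block_mx A 0 0 e%:M]].
Arguments O3_pm1 : clear implicits.

(** The Euclidean norm; the library norm [`|b|] on matrices is the sup norm. *)
Definition euclidean_norm (R : realType) (b : 'cV[R]_3) : R :=
  Num.sqrt (\sum_(i < 3) b i 0 ^+ 2).

Definition unit_ball3 (R : realType) : set 'cV[R]_3 :=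
  [set b | euclidean_norm b < 1].
Arguments unit_ball3 : clear implicits.

(** The first two conditions make [invmx B] an actual inverse and the
    square root in the denominator positive. *)
Definition lorentz_decomposition (R : realType) (L : 'M[R]_(3 + 1))
    (B : 'M[R]_3) (b : 'cV[R]_3) (a : R) : Prop :=
  [/\ B \in unitmx, unit_ball3 R b,
      B^T *m B + b *m b^T = 1%:M,
      (a = 1 / Num.sqrt (1 - euclidean_norm b ^+ 2) \/
       a = - (1 / Num.sqrt (1 - euclidean_norm b ^+ 2))) &
      L = block_mx 1%:M b b^T 1%:M *m block_mx (invmx B) 0 0 a%:M].

(** The projection L |-> beta read off the decomposition of L (0 is a junk
    value, taken only outside the Lorentz group). *)
Definition velocity (R : realType) (L : 'M[R]_(3 + 1)) : 'cV[R]_3 :=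
  xget 0 [set b | exists B a, lorentz_decomposition L B b a].

Definition affine_map (R : realType) (p : 'M[R]_(3 + 1) * spacetime R)
    (X : spacetime R) : spacetime R :=
  p.1 *m X + p.2.

(** The Poincare group, each affine automorphism X |-> L X + C being given by
    its coefficients (L, C); this fixes its topology and its smooth structure. *)
Definition poincare_group (R : realType) :
    set ('M[R]_(3 + 1) * spacetime R) :=
  [set p | inertial_automorphism (affine_map p)].
Arguments poincare_group : clear implicits.

(* Main.v *)
Require Import Defs.
From HB Require Import structures.
From mathcomp Require Import all_boot all_order all_algebra.
From mathcomp Require Import all_classical all_reals all_analysis.
From mathcomp Require Import ring lra.
Import Order.TTheory GRing.Theory Num.Theory.
Import numFieldNormedType.Exports.
Local Open Scope classical_set_scope.
Local Open Scope ring_scope.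

(** An inertial automorphism g preserves the polar form; since it is onto and the
    form is nondegenerate, X |-> g X - g 0 is linear, hence Lorentz.

    Write L in blocks [[P, q], [r, s]].  The relation defining the Lorentz group
    gives s^2 = 1 + |q|^2, so s <> 0, and the decomposition is forced:
    beta = q / s, B = P^-1, a = s.  The symmetric boost S(beta) of velocity beta
    is smooth in beta, and L |-> (beta, S(beta)^-1 L) trivializes the projection
    L |-> beta, with inverse (beta, M) |-> S(beta) M.

    The Cayley transform is a rational chart of the Lorentz group at the
    identity, with values in the 6-dimensional space of matrices K such that
    G K is skew.

    For the components, t |-> S(t beta) joins L to its image in O(3) x {1, -1}.
    A rotation A of trace >= 0 is joined to 1 by t |-> cayley (t cayley A); any
    rotation A becomes one of trace >= 0 after multiplication by a signed cyclic
    permutation matrix Q, the sum of the four matrices Q of determinant 1 on a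
    given cycle being 0, and Q has trace 0.  The signs of det L and of s separate
    the four components. *)

Set Implicit Arguments.
Unset Strict Implicit.
Unset Printing Implicit Defensive.

(** * Smooth maps *)

Section smooth_calculus.
Context {R : realType}.
Implicit Types V W Z : normedModType R.

Lemma Ck_open_continuous V W k (U : set V) (f : V -> W) x :
  Ck_open k U f -> U x -> {for x, continuous f}.
Proof. by case: k => [|k] [cf _]; exact: cf. Qed.

Lemma Ck_openW V W k (U : set V) (f : V -> W) :
  Ck_open k.+1 U f -> Ck_open k U f.
Proof.
elim: k f => [|k IH] f [cf df]; split => // v.
by split; [exact: (df v).1|exact: IH (df v).2].
Qed.

Lemma near_open V (U : set V) (P : V -> Prop) x :
  open U -> U x -> (forall y, U y -> P y) -> \forall y \near x, P y.
Proof. by move=> oU Ux PU; apply: filterS (open_nbhs_nbhs (conj oU Ux)). Qed.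

(** Since U is open, equality on U is equality near each of its points, so it passes to directional
    derivatives. This is how a derivative is replaced by a formula valid only on U. *)
Lemma Ck_open_eq V W k (U : set V) (f g : V -> W) : open U ->
  (forall x, U x -> f x = g x) -> Ck_open k U f -> Ck_open k U g.
Proof.
move=> oU; elim: k f g => [|k IH] f g fg [cf df].
  split=> // x Ux; rewrite /prop_for /continuous_at -(fg x Ux).
  apply: (cvg_trans _ (cf x Ux)); apply: near_eq_cvg.
  exact: (near_open oU Ux fg).
split=> [x Ux|v].
  rewrite /prop_for /continuous_at -(fg x Ux).
  apply: (cvg_trans _ (cf x Ux)); apply: near_eq_cvg.
  exact: (near_open oU Ux fg).
split=> [x Ux|].
  by apply: near_eq_derivable ((df v).1 x Ux); exact: (near_open oU Ux fg).
apply: IH (df v).2 => x Ux; apply: near_eq_derive; exact: (near_open oU Ux fg).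
Qed.

Lemma Ck_open_cst V W k (U : set V) (w : W) : Ck_open k U (fun=> w).
Proof.
elim: k w => [|k IH] w; split=> //.
- by move=> x _; exact: cvg_cst.
- by move=> x _; exact: cvg_cst.
move=> v.
split=> [x _|]; first exact: derivable_cst.
rewrite (_ : (fun x => 'D_v _ x) = fun=> 0); first exact: IH.
by apply/funext => x; exact: derive_cst.
Qed.

Lemma Ck_openD V W k (U : set V) (f g : V -> W) : open U ->
  Ck_open k U f -> Ck_open k U g -> Ck_open k U (fun x => f x + g x).
Proof.
move=> oU; elim: k f g => [|k IH] f g [cf df] [cg dg].
  by split=> // x Ux; apply: cvgD; [exact: cf|exact: cg].
split=> [x Ux|v]; first by apply: cvgD; [exact: cf|exact: cg].
split=> [x Ux|]; first by apply: derivableD; [exact: (df v).1|exact: (dg v).1].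
apply: Ck_open_eq (IH _ _ (df v).2 (dg v).2) => // x Ux.
by rewrite -deriveD //; [exact: (df v).1|exact: (dg v).1].
Qed.

Lemma Ck_open_sum V W k (U : set V) (I : Type) (r : seq I) (P : pred I)
    (f : I -> V -> W) : open U ->
  (forall i, Ck_open k U (f i)) -> Ck_open k U (fun x => \sum_(i <- r | P i) f i x).
Proof.
move=> oU cf; elim: r => [|i r IH].
  by under eq_fun do rewrite big_nil; exact: Ck_open_cst.
under eq_fun do rewrite big_cons.
by case: (P i) => //; exact: Ck_openD.
Qed.

(** By the Leibniz rule the derivative is a sum of products of functions that are at least C^k, to
    which the induction applies. *)
Lemma Ck_openM V k (U : set V) (f g : V -> R) : open U ->
  Ck_open k U f -> Ck_open k U g -> Ck_open k U (fun x => f x * g x).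
Proof.
move=> oU; elim: k f g => [|k IH] f g Cf Cg.
  split=> // x Ux; apply: cvgM.
    exact: Ck_open_continuous Cf Ux.
  exact: Ck_open_continuous Cg Ux.
split=> [x Ux|v].
  apply: cvgM.
    exact: Ck_open_continuous Cf Ux.
  exact: Ck_open_continuous Cg Ux.
have [/(_ v)[df Cdf] /(_ v)[dg Cdg]] := (Cf.2, Cg.2).
split=> [x Ux|]; first by apply: derivableM; [exact: df|exact: dg].
have C := Ck_openD oU (IH _ _ (Ck_openW Cf) Cdg) (IH _ _ (Ck_openW Cg) Cdf).
apply: Ck_open_eq C => // x Ux.
by rewrite -deriveM //; [exact: df|exact: dg].
Qed.

Lemma Ck_open_prod V k (U : set V) (I : Type) (r : seq I) (P : pred I)
    (f : I -> V -> R) : open U ->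
  (forall i, Ck_open k U (f i)) -> Ck_open k U (fun x => \prod_(i <- r | P i) f i x).
Proof.
move=> oU cf; elim: r => [|i r IH].
  by under eq_fun do rewrite big_nil; exact: Ck_open_cst.
under eq_fun do rewrite big_cons.
by case: (P i) => //; exact: Ck_openM.
Qed.

(** The derivative of 1/f is -(1/f)(1/f) f', in which 1/f is C^k by induction. *)
Lemma Ck_openV V k (U : set V) (f : V -> R) : open U ->
  (forall x, U x -> f x != 0) ->
  Ck_open k U f -> Ck_open k U (fun x => (f x)^-1).
Proof.
move=> oU f0; elim: k f f0 => [|k IH] f f0 Cf.
  by split=> // x Ux; apply: cvgV (f0 _ Ux) (Ck_open_continuous Cf Ux).
split=> [x Ux|v].
  by apply: cvgV (f0 _ Ux) (Ck_open_continuous Cf Ux).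
have [df Cdf] := Cf.2 v.
split=> [x Ux|]; first by apply: derivableV; [exact: f0|exact: df].
have Cf' := Ck_openW Cf.
have C := Ck_openM oU (Ck_openM oU (Ck_open_cst k U (-1 : R))
  (Ck_openM oU (IH f f0 Cf') (IH f f0 Cf'))) Cdf.
apply: Ck_open_eq C => // x Ux.
rewrite deriveV //; [|exact: f0|exact: df].
by rewrite /GRing.scale /= expr2 invfM mulN1r.
Qed.

(** Reduces a directional derivative to one real variable, where the chain rule with the square root
    is available. *)
Lemma derive_line V (f : V -> R) x v :
  'D_v f x = 'D_1 (fun h : R => f (h *: v + x)) 0.
Proof.
rewrite /derive; set g1 := fun h => h^-1 *: _; set g2 := fun h => h^-1 *: _.
suff -> : g1 = g2 by [].
by apply/funext => h; rewrite /g1 /g2 /= addr0 scale0r add0r [_%:A]mulr1.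
Qed.

Lemma is_derive_sqrt_comp V (f : V -> R) x v : 0 < f x -> derivable f x v ->
  is_derive x v (fun y => Num.sqrt (f y)) ('D_v f x * (2 * Num.sqrt (f x))^-1).
Proof.
move=> fx0 df.
pose g (h : R) := f (h *: v + x).
have g0 : g 0 = f x by rewrite /g scale0r add0r.
have dg : is_derive (0 : R) 1 g ('D_v f x).
  apply: DeriveDef; first exact: (derivable1P f x v).1 df.
  exact/esym/derive_line.
have ds : is_derive (g 0) 1 (@Num.sqrt R) (2 * Num.sqrt (f x))^-1.
  by rewrite g0; exact: is_derive1_sqrt.
have dc := is_derive1_comp ds dg.
apply: DeriveDef.
  by apply: (derivable1P _ x v).2; case: dc.
by rewrite [LHS]derive_line mulrC; case: dc.
Qed.

(** The derivative f' / (2 sqrt f) involves sqrt f itself, known to be C^k by induction. *)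
Lemma Ck_open_sqrt V k (U : set V) (f : V -> R) : open U ->
  (forall x, U x -> 0 < f x) ->
  Ck_open k U f -> Ck_open k U (fun x => Num.sqrt (f x)).
Proof.
move=> oU f0; elim: k => [|k IH] Cf.
  split=> // x Ux.
  apply: continuous_comp; first exact: Ck_open_continuous Cf Ux.
  exact: sqrt_continuous.
split=> [x Ux|v].
  apply: continuous_comp; first exact: Ck_open_continuous Cf Ux.
  exact: sqrt_continuous.
have [df Cdf] := Cf.2 v.
have ds x (Ux : U x) := is_derive_sqrt_comp (f0 x Ux) (df x Ux).
split=> [x Ux|]; first by have [] := ds x Ux.
have C2 := Ck_openM oU (Ck_open_cst k U (2 : R)) (IH (Ck_openW Cf)).
have C := Ck_openM oU Cdf (Ck_openV oU _ C2).
apply: Ck_open_eq (C _) => //= x Ux.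
  by have [_ ->] := ds x Ux.
by rewrite mulf_neq0 // gt_eqF // sqrtr_gt0 f0.
Qed.

(** A continuous linear map commutes with difference quotients and with their limits, so that D_v (l
    o f) = l o D_v f. *)
Lemma Ck_open_linear_comp V W Z k (U : set V) (f : V -> W) (l : {linear W -> Z}) :
  open U -> continuous l -> Ck_open k U f -> Ck_open k U (fun x => l (f x)).
Proof.
move=> oU cl; elim: k f => [|k IH] f Cf.
  split=> // x Ux.
  by apply: continuous_comp; [exact: Ck_open_continuous Cf Ux|exact: cl].
split=> [x Ux|v].
  by apply: continuous_comp; [exact: Ck_open_continuous Cf Ux|exact: cl].
have [df Cdf] := Cf.2 v.
have lf x (Ux : U x) :
    (fun h => h^-1 *: (((fun x => l (f x)) \o shift x) (h *: v) - l (f x)))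
      @ 0^' --> l ('D_v f x).
  rewrite [X in X @ _](_ : _ = l \o
      (fun h => h^-1 *: ((f \o shift x) (h *: v) - f x))); last first.
    by apply/funext => h /=; rewrite linearZZ (linearB l).
  exact: (cvg_comp _ _ (df x Ux) (cl _)).
split=> [x Ux|]; first by apply/cvg_ex; exists (l ('D_v f x)); exact: lf.
apply: Ck_open_eq (IH _ Cdf) => // x Ux.
by apply/esym/cvg_lim => //; exact: lf.
Qed.

(** The difference quotient of f o l at x along v equals that of f at l x along l v, even before
    passing to the limit. *)
Lemma Ck_open_comp_linear V W Z k (U : set W) (f : W -> Z) (l : {linear V -> W}) :
  continuous l -> Ck_open k U f -> Ck_open k (l @^-1` U) (fun x => f (l x)).
Proof.
move=> cl; elim: k f => [|k IH] f Cf.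
  split=> // x Ux.
  by apply: continuous_comp; [exact: cl|exact: Ck_open_continuous Cf Ux].
split=> [x Ux|v].
  by apply: continuous_comp; [exact: cl|exact: Ck_open_continuous Cf Ux].
have [df Cdf] := Cf.2 (l v).
have E x : (fun h => h^-1 *: (((fun x => f (l x)) \o shift x) (h *: v) - f (l x)))
    = (fun h => h^-1 *: ((f \o shift (l x)) (h *: l v) - f (l x))).
  by apply/funext => h /=; rewrite linearP.
split=> [x Ux|]; first by rewrite /derivable E; exact: df.
have -> : 'D_v (fun x => f (l x)) = fun x => 'D_(l v) f (l x).
  by apply/funext => x; rewrite /derive E.
exact: (IH _ Cdf).
Qed.

Lemma Ck_open_linear V W k (U : set V) (l : {linear V -> W}) :
  continuous l -> Ck_open k U l.
Proof.
move=> cl; case: k => [|k]; split=> //.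
- by move=> x _; exact: cl.
- by move=> x _; exact: cl.
move=> v.
have E x : (fun h => h^-1 *: ((l \o shift x) (h *: v) - l x)) @ 0^' --> l v.
  (* The difference quotient equals l v as soon as h is nonzero, hence on a punctured neighbourhood
     of 0. *)
  apply: (cvg_near_cst (l v)); near=> h => /=.
  rewrite linearP addrK scalerA mulVf ?scale1r//.
  by near: h; exact: nbhs_dnbhs_neq.
split=> [x _|]; first by apply/cvg_ex; exists (l v); exact: E.
have -> : 'D_v l = fun=> l v.
  by apply/funext => x; apply: cvg_lim => //; exact: E.
exact: Ck_open_cst.
Unshelve. all: by end_near. Qed.

End smooth_calculus.

(** * Smoothness of matrix operations *)

Section smooth_matrices.
Context {R : realType}.
Implicit Types V W Z : normedModType R.

(** This map, the entries of a matrix and the two injections into a product are named so that a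
    linear structure can be attached to them. *)
Definition scale_by V (w : V) (r : R) : V := r *: w.
Lemma scale_by_linear V (w : V) : linear (scale_by w).
Proof. by move=> a r s; rewrite /scale_by scalerDl scalerA. Qed.
HB.instance Definition _ V (w : V) :=
  GRing.isLinear.Build R R V _ (scale_by w) (scale_by_linear w).

Definition coord_mx m n i j (M : 'M[R]_(m, n)) : R := M i j.
Lemma coord_mx_linear m n i j : linear (@coord_mx m n i j).
Proof. by move=> a r s; rewrite /coord_mx !mxE. Qed.
HB.instance Definition _ m n i j :=
  GRing.isLinear.Build R 'M[R]_(m, n) R _ (coord_mx i j) (@coord_mx_linear m n i j).

Definition pair_l V W (v : V) : V * W := (v, 0).
Lemma pair_l_linear V W : linear (@pair_l V W).
Proof. by move=> a r s; congr pair; rewrite /= scaler0 addr0. Qed.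
HB.instance Definition _ V W :=
  GRing.isLinear.Build R V (V * W)%type _ (@pair_l V W) (@pair_l_linear V W).

Definition pair_r V W (w : W) : V * W := (0, w).
Lemma pair_r_linear V W : linear (@pair_r V W).
Proof. by move=> a r s; congr pair; rewrite /= scaler0 addr0. Qed.
HB.instance Definition _ V W :=
  GRing.isLinear.Build R W (V * W)%type _ (@pair_r V W) (@pair_r_linear V W).

Lemma Ck_open_scale V W k (U : set V) (f : V -> R) (w : W) : open U ->
  Ck_open k U f -> Ck_open k U (fun x => f x *: w).
Proof.
move=> oU; apply: (@Ck_open_linear_comp _ _ _ _ _ _ _ (scale_by w)) => //.
by move=> r; apply: cvgZr_tmp; exact: cvg_id.
Qed.

Lemma Ck_open_coord V k (U : set V) m n (f : V -> 'M[R]_(m, n)) i j : open U ->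
  Ck_open k U f -> Ck_open k U (fun x => f x i j).
Proof.
move=> oU; apply: (@Ck_open_linear_comp _ _ _ _ _ _ _ (coord_mx i j)) => //.
exact: coord_continuous.
Qed.

(** Expanding f over the matrices [delta_mx i j] reduces smoothness to that of the entries. *)
Lemma Ck_open_mx V k (U : set V) m n (f : V -> 'M[R]_(m, n)) : open U ->
  (forall i j, Ck_open k U (fun x => f x i j)) -> Ck_open k U f.
Proof.
move=> oU cf; rewrite (_ : f = fun x => \sum_i \sum_j f x i j *: delta_mx i j).
  by do 2![apply: Ck_open_sum => // ?]; exact: Ck_open_scale.
by apply/funext => x; exact: matrix_sum_delta.
Qed.

Lemma Ck_open_pair V W Z k (U : set V) (f : V -> W) (g : V -> Z) : open U ->
  Ck_open k U f -> Ck_open k U g -> Ck_open k U (fun x => (f x, g x)).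
Proof.
move=> oU cf cg; rewrite (_ : (fun x => _) = fun x => pair_l Z (f x) + pair_r W (g x)).
  apply: Ck_openD => //; apply: Ck_open_linear_comp => //.
    by move=> w; apply: cvg_pair; [exact: cvg_id|exact: cvg_cst].
  by move=> w; apply: cvg_pair; [exact: cvg_cst|exact: cvg_id].
by apply/funext => x; congr pair; rewrite /= ?addr0 ?add0r.
Qed.

Lemma Ck_open_id V k (U : set V) : Ck_open k U id.
Proof. by apply: (@Ck_open_linear _ _ _ _ _ idfun) => x; exact: cvg_id. Qed.

(** Finite dimension replaces a continuity hypothesis: l is a sum of entries times fixed vectors.
    Its continuity is then the case k = 0. *)
Lemma Ck_open_linear_mx W m n k U (l : {linear 'M[R]_(m, n) -> W}) : open U ->
  Ck_open k U l.
Proof.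
move=> oU; rewrite (_ : (l : _ -> _) = 
    fun X : 'M[R]_(m, n) => \sum_i \sum_j X i j *: l (delta_mx i j)).
  do 2![apply: Ck_open_sum => // ?]; apply: Ck_open_scale => //.
  by apply: Ck_open_coord => //; exact: Ck_open_id.
apply/funext => X; rewrite [in LHS](matrix_sum_delta X) linear_sum.
apply: eq_bigr => i _; rewrite linear_sum; apply: eq_bigr => j _.
by rewrite linearZ.
Qed.

Lemma linear_mx_continuous W m n (l : {linear 'M[R]_(m, n) -> W}) : continuous l.
Proof. by move=> x; apply: (@Ck_open_linear_mx _ _ _ 0 setT l openT).1. Qed.

Lemma Ck_open_fst V W k (U : set (V * W)) : Ck_open k U fst.
Proof. by apply: (@Ck_open_linear _ _ _ _ _ fst) => x; exact: cvg_fst. Qed.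

Lemma Ck_open_snd V W k (U : set (V * W)) : Ck_open k U snd.
Proof. by apply: (@Ck_open_linear _ _ _ _ _ snd) => x; exact: cvg_snd. Qed.

Lemma Ck_open_mulmx V k (U : set V) m n p
    (f : V -> 'M[R]_(m, n)) (g : V -> 'M[R]_(n, p)) : open U ->
  Ck_open k U f -> Ck_open k U g -> Ck_open k U (fun x => f x *m g x).
Proof.
move=> oU cf cg; apply: Ck_open_mx => // i j; under eq_fun do rewrite mxE.
by apply: Ck_open_sum => // l; apply: Ck_openM => //; exact: Ck_open_coord.
Qed.

Lemma Ck_openZ V k (U : set V) m n (f : V -> R) (g : V -> 'M[R]_(m, n)) : open U ->
  Ck_open k U f -> Ck_open k U g -> Ck_open k U (fun x => f x *: g x).
Proof.
move=> oU cf cg; apply: Ck_open_mx => // i j; under eq_fun do rewrite mxE.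
by apply: Ck_openM => //; exact: Ck_open_coord.
Qed.

Lemma Ck_open_det V k (U : set V) n (f : V -> 'M[R]_n) : open U ->
  Ck_open k U f -> Ck_open k U (fun x => \det (f x)).
Proof.
move=> oU cf; apply: Ck_open_sum => // s; apply: Ck_openM => //.
  exact: Ck_open_cst.
by apply: Ck_open_prod => // i; exact: Ck_open_coord.
Qed.

(** By Cramer's rule the inverse is the adjugate, whose entries are determinants up to sign, divided
    by the determinant. *)
Lemma Ck_open_invmx V k (U : set V) n (f : V -> 'M[R]_n) : open U ->
  (forall x, U x -> f x \in unitmx) ->
  Ck_open k U f -> Ck_open k U (fun x => invmx (f x)).
Proof.
move=> oU uf cf.
apply: (@Ck_open_eq _ _ _ _ _ (fun x => (\det (f x))^-1 *: \adj (f x))) => //.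
  by move=> x Ux; rewrite /invmx uf.
apply: Ck_openZ => //.
  apply: Ck_openV => // [x /uf|]; first by rewrite unitmxE unitfE.
  exact: Ck_open_det.
apply: Ck_open_mx => // i j; under eq_fun do rewrite mxE.
apply: Ck_openM => //; first exact: Ck_open_cst.
apply: Ck_open_det => //; apply: Ck_open_mx => // a b.
under eq_fun do rewrite !mxE.
exact: Ck_open_coord.
Qed.

Lemma Ck_openB V W k (U : set V) (f g : V -> W) : open U ->
  Ck_open k U f -> Ck_open k U g -> Ck_open k U (fun x => f x - g x).
Proof.
move=> oU cf cg; apply: Ck_openD => //.
apply: (@Ck_open_linear_comp _ _ _ _ _ _ _ (GRing.opp : W -> W)) => //.
by move=> x; apply: cvgN; exact: cvg_id.
Qed.

Lemma smooth_open_on V W (S U : set V) (F f : V -> W) :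
  open U -> S `<=` U -> (forall y, S y -> F y = f y) -> smooth_open U F ->
  smooth_on S f.
Proof.
by move=> oU SU Ff sF x Sx; exists U, F; split => // [|y Sy _]; [exact: SU|exact: Ff].
Qed.

Lemma Ck_open_block V k (U : set V) m1 m2 n1 n2 (f : V -> 'M[R]_(m1, n1))
    (g : V -> 'M[R]_(m1, n2)) (h : V -> 'M[R]_(m2, n1)) (l : V -> 'M[R]_(m2, n2)) :
  open U -> Ck_open k U f -> Ck_open k U g -> Ck_open k U h -> Ck_open k U l ->
  Ck_open k U (fun x => block_mx (f x) (g x) (h x) (l x)).
Proof.
move=> oU cf cg ch cl; apply: Ck_open_mx => // i j.
case: (split_ordP i) => {}i ->; case: (split_ordP j) => {}j ->.
- by under eq_fun do rewrite block_mxEul; exact: Ck_open_coord.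
- by under eq_fun do rewrite block_mxEur; exact: Ck_open_coord.
- by under eq_fun do rewrite block_mxEdl; exact: Ck_open_coord.
- by under eq_fun do rewrite block_mxEdr; exact: Ck_open_coord.
Qed.

Lemma Ck_open_mxsub V k (U : set V) m n m' n' (a : 'I_m' -> 'I_m)
    (b : 'I_n' -> 'I_n) (f : V -> 'M[R]_(m, n)) : open U ->
  Ck_open k U f -> Ck_open k U (fun x => mxsub a b (f x)).
Proof.
move=> oU cf; apply: Ck_open_mx => // i j; under eq_fun do rewrite mxE.
exact: Ck_open_coord.
Qed.

Lemma Ck_open_tr V k (U : set V) m n (f : V -> 'M[R]_(m, n)) : open U ->
  Ck_open k U f -> Ck_open k U (fun x => (f x)^T).
Proof.
move=> oU cf; apply: Ck_open_mx => // i j; under eq_fun do rewrite mxE.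
exact: Ck_open_coord.
Qed.

Lemma Ck_open_scalar_mx V k (U : set V) n (f : V -> R) : open U ->
  Ck_open k U f -> Ck_open k U (fun x => (f x)%:M : 'M[R]_n).
Proof.
move=> oU cf; under eq_fun do rewrite -scalemx1.
exact: Ck_open_scale.
Qed.

Lemma smooth_open_continuous V W (f : V -> W) :
  smooth_open [set: V] f -> continuous f.
Proof. by move=> sf x; exact: (sf 0).1. Qed.

Lemma open_gt0 V (f : V -> R) : continuous f -> open [set x | 0 < f x].
Proof.
by move=> cf; apply: (open_comp (f := f) (D := [set r | 0 < r])) => // x _; exact: cf.
Qed.

Lemma open_neq0 V (f : V -> R) : continuous f -> open [set x | f x != 0].
Proof.
by move=> cf; apply: (open_comp (f := f) (D := [set r | r != 0])) => // x _; exact: cf.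
Qed.

End smooth_matrices.

(** * Inertial automorphisms *)

Section minkowski.
Context {R : realType}.
Implicit Types (L : 'M[R]_(3 + 1)) (u v w : spacetime R) (b : 'cV[R]_3).

Local Notation G := (poincare_gram R).

(** The square of the Euclidean norm is polynomial, hence smooth at 0 as well. *)
Definition sqnorm n (b : 'cV[R]_n) : R := \sum_(i < n) b i 0 ^+ 2.

Lemma mul_trmx_col n (b : 'cV[R]_n) : b^T *m b = (sqnorm b)%:M.
Proof.
apply/matrixP => i j; rewrite !ord1 !mxE eqxx mulr1n.
by apply: eq_bigr => k _; rewrite mxE expr2.
Qed.

Lemma sqnorm_ge0 n (b : 'cV[R]_n) : 0 <= sqnorm b.
Proof. by apply: sumr_ge0 => i _; exact: sqr_ge0. Qed.

Lemma sqnorm_eq0 n (b : 'cV[R]_n) : sqnorm b = 0 -> b = 0.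
Proof.
move=> /eqP; rewrite psumr_eq0 => [/allP b0|i _]; last exact: sqr_ge0.
apply/matrixP => i j; rewrite !ord1 mxE.
by have := b0 i (mem_index_enum _); rewrite sqrf_eq0 => /eqP.
Qed.

Lemma sqnormZ n (b : 'cV[R]_n) a : sqnorm (a *: b) = a ^+ 2 * sqnorm b.
Proof. by rewrite mulr_sumr; apply: eq_bigr => i _; rewrite mxE exprMn. Qed.

Lemma gram_tr : G^T = G.
Proof. by rewrite /poincare_gram tr_block_mx !trmx0 !tr_scalar_mx. Qed.

Lemma gramK : G *m G = 1%:M.
Proof.
rewrite /poincare_gram mulmx_block !(mulmx0, mul0mx, mulmx1, addr0, add0r).
by rewrite -scalar_mxM mulrNN mulr1 -scalar_mx_block.
Qed.

Lemma poincare_formE u : poincare_form u = (u^T *m G *m u) 0 0.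
Proof.
rewrite -[in RHS](vsubmxK u) tr_col_mx /poincare_gram mul_row_block.
rewrite !(mulmx0, mulmx1, addr0, add0r) mul_row_col mul_trmx_col mul_mx_scalar.
by rewrite scaleN1r mulNmx !mxE eqxx mulr1n big_ord1 [(dsubmx u)^T _ _]mxE -expr2.
Qed.

Lemma poincare_prodE u v : poincare_prod u v = (u^T *m G *m v) 0 0.
Proof.
rewrite /poincare_prod !poincare_formE [(u + v)^T]linearD /= !mulmxDl !mulmxDr.
(* A 1 x 1 matrix is its own transpose, and G is symmetric. *)
have -> : v^T *m G *m u = u^T *m G *m v.
  by rewrite -[LHS]trmxK [LHS](mx11_scalar _) [RHS]mx11_scalar mxE !trmx_mul trmxK gram_tr mulmxA.
have D (A B : 'M[R]_1) : (A + B) 0 0 = A 0 0 + B 0 0 by rewrite mxE.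
rewrite !D.
set x := (_ *m u) 0 0; set y := (_ *m v) 0 0; set z := (v^T *m G *m v) 0 0.
have -> : x + y + (y + z) - x - z = y * 2 by lra.
by rewrite mulfK// pnatr_eq0.
Qed.

(** Pairing u with [G *m u] gives its Euclidean square, because G is its own inverse. *)
Lemma poincare_prod_nondegenerate u : (forall v, poincare_prod u v = 0) -> u = 0.
Proof.
move=> /(_ (G *m u)); rewrite poincare_prodE -mulmxA [G *m _]mulmxA gramK mul1mx.
by rewrite mul_trmx_col mxE eqxx mulr1n; exact: sqnorm_eq0.
Qed.

Lemma poincare_prod_linearl a u v w :
  poincare_prod (a *: u + v) w = a * poincare_prod u w + poincare_prod v w.
Proof.
by rewrite !poincare_prodE [(_ *: u + v)^T]linearP /= !mulmxDl -!scalemxAl mxE [in LHS]mxE.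
Qed.

Lemma lorentzP L : lorentz_group R L <->
  forall u v, poincare_prod (L *m u) (L *m v) = poincare_prod u v.
Proof.
split=> [hL u v|hL].
  rewrite !poincare_prodE trmx_mul -!mulmxA [G *m (L *m v)]mulmxA [L^T *m _]mulmxA.
  by rewrite [L^T *m (G *m L)]mulmxA hL.
(* The entries of a matrix are the values of its bilinear form on the basis vectors. *)
have E (A : 'M[R]_(3 + 1)) i j :
    A i j = ((delta_mx i 0 : spacetime R)^T *m A *m (delta_mx j 0 : spacetime R)) 0 0.
  by rewrite trmx_delta -rowE -colE !mxE.
apply/matrixP => i j; rewrite E [RHS]E -poincare_prodE -hL poincare_prodE.
by rewrite trmx_mul !mulmxA.
Qed.

Lemma lorentz1 : lorentz_group R 1%:M.
Proof. by rewrite /lorentz_group /= trmx1 mul1mx mulmx1. Qed.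

Lemma lorentzM L M : lorentz_group R L -> lorentz_group R M ->
  lorentz_group R (L *m M).
Proof.
move=> /lorentzP hL /lorentzP hM; apply/lorentzP => u v.
by rewrite -!mulmxA hL hM.
Qed.

(** Multiplying the defining relation by G on the left exhibits an inverse of L that is polynomial
    in L. *)
Lemma lorentz_mulVmx L : lorentz_group R L -> (G *m L^T *m G) *m L = 1%:M.
Proof. by move=> hL; rewrite -!mulmxA [L^T *m _]mulmxA hL gramK. Qed.

Lemma lorentz_unit L : lorentz_group R L -> L \in unitmx.
Proof. by move=> /lorentz_mulVmx/mulmx1_unit[]. Qed.

Lemma lorentz_invmx L : lorentz_group R L -> invmx L = G *m L^T *m G.
Proof.
move=> hL; rewrite -[LHS]mul1mx -(lorentz_mulVmx hL) mulmxK //.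
exact: lorentz_unit.
Qed.

Lemma lorentzV L : lorentz_group R L -> lorentz_group R (invmx L).
Proof.
move=> hL; apply/lorentzP => u v; have /lorentzP <- := hL.
by rewrite !mulKVmx // lorentz_unit.
Qed.

Lemma lorentz_gram : lorentz_group R G.
Proof. by rewrite /lorentz_group /= gram_tr gramK mul1mx. Qed.

Lemma lorentz_inertial L (C : spacetime R) (g : spacetime R -> spacetime R) :
  lorentz_group R L -> (forall X, g X = L *m X + C) -> inertial_automorphism g.
Proof.
move=> hL gE; have uL := lorentz_unit hL; split.
- exists (fun X => invmx L *m (X - C)) => X; rewrite gE.
    by rewrite addrK mulKmx.
  by rewrite mulKVmx // subrK.
- move=> D [P [u [u0 ->]]]; exists (g P), (L *m u); split.
    apply: contraNneq u0 => Lu0.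
    by rewrite -(mulKmx uL u) Lu0 mulmx0.
  apply/seteqP; split=> [_ [_ [s _ <-] <-]|_ [s _ <-]].
    by exists s => //; rewrite !gE mulmxDr -scalemxAr addrAC.
  exists (P + s *: u); first by exists s.
  by rewrite !gE mulmxDr -scalemxAr addrAC.
- move=> X u v.
  have D w : g (X + w) - g X = L *m w.
    by rewrite !gE mulmxDr opprD addrACA subrr addr0 [L *m X + _]addrC addrK.
  by rewrite !D; have /lorentzP -> := hL.
Qed.

Lemma inertial_lorentz (g : spacetime R -> spacetime R) :
  inertial_automorphism g ->
  exists L (C : spacetime R), lorentz_group R L /\ forall X, g X = L *m X + C.
Proof.
move=> [[g' gK g'K] _ /(_ 0) gQ].
pose f u := g u - g 0.
have fQ u v : poincare_prod (f u) (f v) = poincare_prod u v.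
  by rewrite -(gQ u v) !add0r.
have f_lin : linear f.
  move=> a u v; apply/eqP; rewrite -subr_eq0; apply/eqP.
  apply: poincare_prod_nondegenerate => w.
  (* Surjectivity lets every test vector be written f z, so that the defect of linearity is paired
     with it through [fQ] alone. *)
  have [z <-] : exists z, f z = w by exists (g' (w + g 0)); rewrite /f g'K addrK.
  rewrite [X in poincare_prod X](_ : _ = -1 *: (a *: f u + f v) + f (a *: u + v)).
    by rewrite 2!poincare_prod_linearl !fQ poincare_prod_linearl; lra.
  by rewrite scaleN1r [RHS]addrC.
pose F : {linear spacetime R -> spacetime R} :=
  HB.pack f (GRing.isLinear.Build R _ _ _ f f_lin).
pose L := \matrix_(i, j) F (delta_mx j 0) i 0.
have FE u : f u = L *m u.
  rewrite -[f u]/(F u) [in LHS](matrix_sum_delta u) linear_sum.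
  apply/matrixP => i j; rewrite ord1 summxE mxE; apply: eq_bigr => k _.
  by rewrite big_ord1 linearZ /= !mxE mulrC.
exists L, (g 0); split; last by move=> X; rewrite -FE subrK.
by apply/lorentzP => u v; rewrite -!FE.
Qed.

Lemma inertialP (g : spacetime R -> spacetime R) :
  inertial_automorphism g <-> exists L (C : spacetime R),
    [/\ L \in unitmx, lorentz_group R L & forall X, g X = L *m X + C].
Proof.
split=> [/inertial_lorentz[L [C [hL gE]]]|[L [C [_ hL gE]]]].
  by exists L, C; split=> //; exact: lorentz_unit.
exact: lorentz_inertial gE.
Qed.

Lemma inertial_id : inertial_automorphism (@id (spacetime R)).
Proof. by apply: (lorentz_inertial (C := 0) lorentz1) => X; rewrite mul1mx addr0. Qed.

Lemma inertial_comp (g1 g2 : spacetime R -> spacetime R) :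
  inertial_automorphism g1 -> inertial_automorphism g2 ->
  inertial_automorphism (g1 \o g2).
Proof.
move=> /inertial_lorentz[L [C [hL gE]]] /inertial_lorentz[L' [C' [hL' gE']]].
apply: (lorentz_inertial (C := L *m C' + C) (lorentzM hL hL')) => X.
by rewrite /= gE gE' mulmxDr addrA mulmxA.
Qed.

Lemma inertial_inv (g : spacetime R -> spacetime R) : inertial_automorphism g ->
  exists g' : spacetime R -> spacetime R,
    [/\ inertial_automorphism g', cancel g g' & cancel g' g].
Proof.
move=> /inertial_lorentz[L [C [hL gE]]]; have uL := lorentz_unit hL.
exists (fun X => invmx L *m X + - (invmx L *m C)); split.
- exact: lorentz_inertial (lorentzV hL) _.
- by move=> X; rewrite gE mulmxDr mulKmx // addrK.
- by move=> X; rewrite gE mulmxDr mulmxN !mulKVmx // subrK.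
Qed.

(** The coefficients are recovered from the map: its value at 0 is C, and its values at the basis
    vectors then give the columns of L. *)
Lemma poincare_groupE : poincare_group R = lorentz_group R `*` [set: spacetime R].
Proof.
apply/seteqP; split=> [[L C] /= /inertial_lorentz[L' [C' [hL' E]]]|[L C] /= [hL _]].
  have E0 := E 0; rewrite /affine_map /= !mulmx0 !add0r in E0.
  split => //=; suff -> : L = L' by [].
  apply/matrixP => i j; have := E (delta_mx j 0).
  by rewrite /affine_map /= E0 => /addIr /matrixP/(_ i 0); rewrite -!colE !mxE.
exact: lorentz_inertial hL _.
Qed.

End minkowski.

(** * The velocity fibration *)

Section velocity.
Context {R : realType}.
Implicit Types (L M : 'M[R]_(3 + 1)) (b : 'cV[R]_3).

Local Notation G := (poincare_gram R).

Definition lorentz_time L : R := drsubmx L 0 0.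

(** A rational expression that agrees on the Lorentz group with [velocity], which is defined by
    choice; it provides a smooth extension. *)
Definition beta L : 'cV[R]_3 := (lorentz_time L)^-1 *: ursubmx L.

Definition gamma b : R := (Num.sqrt (1 - sqnorm b))^-1.

Lemma block_mx11 (P : 'M[R]_3) (q : 'cV[R]_3) (r : 'rV[R]_3) (s : 'M[R]_1) :
  block_mx P q r s = block_mx P q r (s 0 0)%:M.
Proof. by rewrite -mx11_scalar. Qed.

Lemma lorentz_blockP (P : 'M[R]_3) (q : 'cV[R]_3) (r : 'rV[R]_3) (s : R) :
  lorentz_group R (block_mx P q r s%:M) <->
  [/\ P^T *m P - r^T *m r = 1%:M, P^T *m q = s *: r^T & sqnorm q = s ^+ 2 - 1].
Proof.
have E : (block_mx P q r s%:M)^T *m G *m block_mx P q r s%:M =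
    block_mx (P^T *m P - r^T *m r) (P^T *m q - s *: r^T)
             (q^T *m P - s *: r) (sqnorm q - s ^+ 2)%:M.
  rewrite tr_block_mx !mulmx_block !(mulmx0, mulmx1, addr0, add0r).
  rewrite !mul_mx_scalar !scaleN1r !mulNmx mul_trmx_col tr_scalar_mx.
  by rewrite mul_scalar_mx !scalerN scale_scalar_mx -raddfB /= expr2.
split=> [|[h1 h2 h3]]; rewrite /lorentz_group /= E.
  rewrite /poincare_gram => /eq_block_mx[-> /eqP + _ /matrixP/(_ 0 0)].
  by rewrite subr_eq0 => /eqP -> ; rewrite !mxE !eqxx !mulr1n => h; split=> //; lra.
(* The remaining off-diagonal block is the transpose of the second condition. *)
have h4 : q^T *m P = s *: r.
  by rewrite -[LHS]trmxK trmx_mul trmxK h2 linearZ /= trmxK.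
rewrite h1 h2 h3 h4 !subrr /poincare_gram; congr block_mx; congr (_%:M); lra.
Qed.

Lemma lorentz_submxP L : lorentz_group R L ->
  [/\ (ulsubmx L)^T *m ulsubmx L - (dlsubmx L)^T *m dlsubmx L = 1%:M,
      (ulsubmx L)^T *m ursubmx L = lorentz_time L *: (dlsubmx L)^T &
      sqnorm (ursubmx L) = lorentz_time L ^+ 2 - 1].
Proof. by rewrite -{1}(submxK L) block_mx11 => /lorentz_blockP. Qed.

Lemma lorentz_time_neq0 L : lorentz_group R L -> lorentz_time L != 0.
Proof.
move=> /lorentz_submxP[_ _ h]; apply/eqP => s0.
have := sqnorm_ge0 (ursubmx L); rewrite h s0; lra.
Qed.

Lemma sqnorm_beta L : lorentz_group R L ->
  1 - sqnorm (beta L) = (lorentz_time L ^+ 2)^-1.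
Proof.
move=> hL; have s0 := lorentz_time_neq0 hL; have [_ _ h] := lorentz_submxP hL.
by rewrite /beta sqnormZ h; field.
Qed.

Lemma beta_lt1 L : lorentz_group R L -> sqnorm (beta L) < 1.
Proof.
move=> hL; rewrite -subr_gt0 sqnorm_beta // invr_gt0 exprn_even_gt0 //=.
exact: lorentz_time_neq0.
Qed.

Lemma dlsubmx_lorentz L : lorentz_group R L ->
  dlsubmx L = (beta L)^T *m ulsubmx L.
Proof.
move=> hL; have s0 := lorentz_time_neq0 hL; have [_ h _] := lorentz_submxP hL.
apply: trmx_inj; rewrite trmx_mul trmxK /beta -scalemxAr h scalerA.
by rewrite mulVf // scale1r.
Qed.

(** Substitutes r = beta^T P in P^T P - r^T r = 1. Conjugated by B = P^-1, this is the required B^T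
    B + beta beta^T = 1. *)
Lemma beta_gram L : lorentz_group R L ->
  (ulsubmx L)^T *m (1%:M - beta L *m (beta L)^T) *m ulsubmx L = 1%:M.
Proof.
move=> hL; have [h _ _] := lorentz_submxP hL; rewrite -[RHS]h.
rewrite dlsubmx_lorentz // trmx_mul trmxK mulmxBr mulmx1 mulmxBl.
by rewrite !mulmxA.
Qed.

Lemma euclidean_norm_sqr b : euclidean_norm b ^+ 2 = sqnorm b.
Proof. by rewrite /euclidean_norm sqr_sqrtr // sqnorm_ge0. Qed.

Lemma unit_ball3P b : unit_ball3 R b <-> sqnorm b < 1.
Proof.
rewrite /unit_ball3 /= /euclidean_norm -[X in _ < X]sqrtr1 ltr_sqrt //.
Qed.

Lemma gamma_gt0 b : sqnorm b < 1 -> 0 < gamma b.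
Proof. by move=> b1; rewrite invr_gt0 sqrtr_gt0 subr_gt0. Qed.

Lemma gamma_sqr b : sqnorm b < 1 -> gamma b ^+ 2 = (1 - sqnorm b)^-1.
Proof. by move=> b1; rewrite exprVn sqr_sqrtr // subr_ge0 ltW. Qed.

Lemma lorentz_decomposition_exists L : lorentz_group R L ->
  lorentz_decomposition L (invmx (ulsubmx L)) (beta L) (lorentz_time L).
Proof.
move=> hL; have s0 := lorentz_time_neq0 hL.
have gr := beta_gram hL.
have /mulmx1_unit[_ uP] := gr; have uPt : (ulsubmx L)^T \in unitmx by rewrite unitmx_tr.
split.
- by rewrite unitmx_inv.
- exact/unit_ball3P/beta_lt1.
- apply/eqP; rewrite eq_sym -subr_eq eq_sym; apply/eqP.
  rewrite trmx_inv -[RHS](mulKmx uPt) -[X in _ = _ *m X](mulmxK uP) gr.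
  by rewrite mul1mx.
- rewrite euclidean_norm_sqr div1r -/(gamma _).
  have : lorentz_time L ^+ 2 == gamma (beta L) ^+ 2.
    by rewrite gamma_sqr ?beta_lt1// sqnorm_beta // invrK.
  by rewrite eqf_sqr => /orP[] /eqP ->; [left|right].
- rewrite mulmx_block invmxK !(mul1mx, mulmx0, addr0, add0r).
  rewrite -dlsubmx_lorentz // mul_mx_scalar /beta scalerA mulfV // scale1r.
  by rewrite -block_mx11 submxK.
Qed.

(** In the multiplied-out product the upper left block is B^-1 and the last column is (a b, a); as a
    is nonzero, all three factors can be read off. *)
Lemma lorentz_decomposition_inj L B b a : lorentz_decomposition L B b a ->
  [/\ B = invmx (ulsubmx L), b = beta L & a = lorentz_time L].
Proof.
case=> uB /unit_ball3P b1 hB ha ->.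
have a0 : a != 0.
  rewrite euclidean_norm_sqr div1r -/(gamma b) in ha.
  by case: ha => ->; rewrite ?oppr_eq0 gt_eqF // gamma_gt0.
rewrite mulmx_block !(mul1mx, mulmx0, addr0, add0r).
rewrite /beta /lorentz_time block_mxKul block_mxKur block_mxKdr invmxK.
rewrite [a%:M 0 0]mxE eqxx mulr1n; split => //.
by rewrite mul_mx_scalar scalerA mulVf // scale1r.
Qed.

Lemma lorentz_decomposition_unique L : lorentz_group R L ->
  exists! d : 'M[R]_3 * 'cV[R]_3 * R, lorentz_decomposition L d.1.1 d.1.2 d.2.
Proof.
move=> hL; exists (invmx (ulsubmx L), beta L, lorentz_time L); split.
  exact: lorentz_decomposition_exists.
by move=> [[B b] a] /= /lorentz_decomposition_inj[-> -> ->].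
Qed.

Lemma velocityE L : lorentz_group R L -> velocity L = beta L.
Proof.
move=> hL; rewrite /velocity; case: xgetP => [b _ /= [B [a]]|].
  by move=> /lorentz_decomposition_inj[].
move=> /(_ (beta L)) []; exists (invmx (ulsubmx L)), (lorentz_time L).
exact: lorentz_decomposition_exists.
Qed.

(** The usual coefficient (gamma - 1) / |b|^2 is written gamma^2 / (1 + gamma), which is regular at
    b = 0. *)
Definition boost b : 'M[R]_(3 + 1) :=
  block_mx (1%:M + (gamma b ^+ 2 / (1 + gamma b)) *: (b *m b^T))
           (gamma b *: b) (gamma b *: b^T) (gamma b)%:M.

Lemma boost_tr b : (boost b)^T = boost b.
Proof.
rewrite /boost tr_block_mx tr_scalar_mx !linearZ /= trmxK linearD /= trmx1.
by rewrite linearZ /= trmx_mul trmxK.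
Qed.

(** b is an eigenvector because gamma^2 |b|^2 = gamma^2 - 1, so that the second term contributes
    gamma - 1. *)
Lemma boost_col b : sqnorm b < 1 ->
  (1%:M + (gamma b ^+ 2 / (1 + gamma b)) *: (b *m b^T)) *m b = gamma b *: b.
Proof.
move=> b1; have g0 := gamma_gt0 b1.
rewrite mulmxDl mul1mx -scalemxAl -mulmxA mul_trmx_col mul_mx_scalar.
rewrite scalerA -[X in X + _]scale1r -scalerDl; congr (_ *: _).
have -> : sqnorm b = 1 - (gamma b ^+ 2)^-1 by rewrite gamma_sqr // invrK; lra.
by field; rewrite !gt_eqF //; lra.
Qed.

Lemma lorentz_boost b : sqnorm b < 1 -> lorentz_group R (boost b).
Proof.
move=> b1; have g0 := gamma_gt0 b1.
have sE : sqnorm b = 1 - (gamma b ^+ 2)^-1 by rewrite gamma_sqr // invrK; lra.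
have At k : (1%:M + k *: (b *m b^T))^T = 1%:M + k *: (b *m b^T).
  by rewrite linearD /= trmx1 linearZ /= trmx_mul trmxK.
apply/lorentz_blockP; rewrite At; split.
(* With k = gamma^2 / (1 + gamma) and A b = gamma b, A A = 1 + k (1 + gamma) b b^T = 1 + gamma^2 b
   b^T. *)
- set A := 1%:M + _; rewrite {2}/A mulmxDr mulmx1 -scalemxAr mulmxA boost_col // -scalemxAl scalerA.
  rewrite [(gamma b *: b^T)^T]linearZ /= trmxK -scalemxAl -scalemxAr scalerA /A.
  rewrite -!addrA -scalerBl -scalerDl -[RHS]addr0; congr (_ + _).
  rewrite -[RHS](scale0r (b *m b^T)); congr (_ *: _).
  by field; rewrite gt_eqF //; lra.
- by rewrite -scalemxAr boost_col // [(gamma b *: b^T)^T]linearZ /= trmxK.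
- by rewrite sqnormZ sE; field; rewrite gt_eqF.
Qed.

Lemma boostK b : sqnorm b < 1 -> G *m boost b *m G *m boost b = 1%:M.
Proof. by move=> b1; rewrite -{1}boost_tr lorentz_mulVmx //; exact: lorentz_boost. Qed.

Lemma boostVK b : sqnorm b < 1 -> boost b *m (G *m boost b *m G) = 1%:M.
Proof. by move=> b1; apply: mulmx1C; exact: boostK. Qed.

(** For a Lorentz matrix, q = 0 forces s^2 = 1 and beta = 0, hence r = beta^T P = 0, and P is
    orthogonal. *)
Lemma O3_pm1P M : O3_pm1 R M <-> lorentz_group R M /\ ursubmx M = 0.
Proof.
split=> [[A [e [hA he ->]]]|[hM h0]].
  split; last by rewrite block_mxKur.
  apply/lorentz_blockP; rewrite trmx0 !(mulmx0, scaler0, subr0); split => //.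
  rewrite /sqnorm big1 => [|i _]; last by rewrite mxE expr0n.
  by case: he => ->; rewrite ?sqrrN expr1n subrr.
have s0 := lorentz_time_neq0 hM; have [h1 h2 h3] := lorentz_submxP hM.
have r0 : dlsubmx M = 0.
  by rewrite dlsubmx_lorentz // /beta h0 scaler0 trmx0 mul0mx.
rewrite r0 mulmx0 subr0 in h1.
exists (ulsubmx M), (lorentz_time M); split => //.
  have : lorentz_time M ^+ 2 == 1 ^+ 2.
    rewrite expr1n -subr_eq0 -h3 h0 /sqnorm big1 // => i _.
    by rewrite mxE expr0n.
  by rewrite eqf_sqr => /orP[] /eqP ->; [left|right].
by rewrite -[LHS]submxK h0 r0 block_mx11.
Qed.

Lemma beta_boostM b M : sqnorm b < 1 -> O3_pm1 R M -> beta (boost b *m M) = b.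
Proof.
move=> b1 [A [e [_ he ->]]]; have g0 := gamma_gt0 b1.
rewrite /boost mulmx_block !(mulmx0, addr0, add0r) /beta /lorentz_time.
rewrite block_mxKur block_mxKdr -scalar_mxM [_%:M 0 0]mxE eqxx mulr1n.
rewrite mul_mx_scalar !scalerA -[RHS]scale1r; congr (_ *: _).
have e0 : e != 0 by case: he => ->; rewrite ?oppr_eq0 oner_eq0.
by field; rewrite e0 gt_eqF.
Qed.

(** Conjugating by G reverses the velocity, so the factor before L is the inverse boost, in a form
    free of [invmx]. *)
Definition fiber L := G *m boost (beta L) *m G *m L.

Lemma boost_fiber L : lorentz_group R L -> boost (beta L) *m fiber L = L.
Proof. by move=> hL; rewrite /fiber mulmxA boostVK ?mul1mx// beta_lt1. Qed.

Lemma fiber_boost b M : sqnorm b < 1 -> O3_pm1 R M -> fiber (boost b *m M) = M.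
Proof. by move=> b1 hM; rewrite /fiber beta_boostM // mulmxA boostK // mul1mx. Qed.

(** The last column of L is s (beta, 1); the boost of velocity -beta cancels its space part, by
    [boost_col]. *)
Lemma O3_pm1_fiber L : lorentz_group R L -> O3_pm1 R (fiber L).
Proof.
move=> hL; have b1 := beta_lt1 hL; have s0 := lorentz_time_neq0 hL.
have g0 := gamma_gt0 b1.
apply/O3_pm1P; split.
  apply: lorentzM => //; apply: lorentzM lorentz_gram.
  by apply: lorentzM; [exact: lorentz_gram|exact: lorentz_boost].
rewrite /fiber -{2}(submxK L) /poincare_gram /boost !mulmx_block.
rewrite !(mulmx0, mul0mx, mulmx1, mul1mx, addr0, add0r) block_mxKur.
have -> : ursubmx L = lorentz_time L *: beta L by rewrite /beta scalerA mulfV // scale1r.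
rewrite -scalemxAr boost_col // [drsubmx L]mx11_scalar -/(lorentz_time L).
rewrite !mul_mx_scalar scalerA -scalerDl.
by apply/eqP; rewrite scaler_eq0; apply/orP; left; apply/eqP; ring.
Qed.

Lemma O3_pm1_lorentz M : O3_pm1 R M -> lorentz_group R M.
Proof. by move=> /O3_pm1P[]. Qed.

Lemma velocity0_O3_pm1 :
  [set L | lorentz_group R L /\ velocity L = 0] = O3_pm1 R.
Proof.
apply/seteqP; split=> [L [hL]|M hM] /=.
  rewrite velocityE // => /eqP; rewrite /beta scaler_eq0 invr_eq0.
  by rewrite (negbTE (lorentz_time_neq0 hL)) => /eqP h; exact/O3_pm1P.
have [hM' h] := (O3_pm1P M).1 hM.
by split=> //; rewrite velocityE // /beta h scaler0.
Qed.

End velocity.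

(** * Smooth trivialization over the ball of velocities *)

Section fibration.
Context {R : realType}.
Implicit Types V W : normedModType R.

Lemma Ck_open_sqnorm V k (U : set V) n (f : V -> 'cV[R]_n) : open U ->
  Ck_open k U f -> Ck_open k U (fun x => sqnorm (f x)).
Proof.
move=> oU cf; apply: Ck_open_sum => // i; under eq_fun do rewrite expr2.
by apply: Ck_openM => //; exact: Ck_open_coord.
Qed.

Lemma Ck_open_gamma V k (U : set V) (f : V -> 'cV[R]_3) : open U ->
  (forall x, U x -> sqnorm (f x) < 1) ->
  Ck_open k U f -> Ck_open k U (fun x => gamma (f x)).
Proof.
move=> oU f1 cf; apply: Ck_openV => // [x /f1 h|].
  by rewrite gt_eqF // sqrtr_gt0 subr_gt0.
apply: Ck_open_sqrt => // [x /f1|]; first by rewrite subr_gt0.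
by apply: Ck_openB => //; [exact: Ck_open_cst|exact: Ck_open_sqnorm].
Qed.

Lemma Ck_open_boost V k (U : set V) (f : V -> 'cV[R]_3) : open U ->
  (forall x, U x -> sqnorm (f x) < 1) ->
  Ck_open k U f -> Ck_open k U (fun x => boost (f x)).
Proof.
move=> oU f1 cf; have cg := Ck_open_gamma oU f1 cf.
have cft := Ck_open_tr oU cf.
apply: Ck_open_block => //.
- apply: Ck_openD => //; first exact: Ck_open_cst.
  apply: Ck_openZ => //; last exact: Ck_open_mulmx.
  under eq_fun do rewrite expr2.
  apply: Ck_openM => //; first exact: Ck_openM.
  apply: Ck_openV => // [x /f1/gamma_gt0 h|]; first by rewrite gt_eqF //; lra.
  by apply: Ck_openD => //; exact: Ck_open_cst.
- exact: Ck_openZ.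
- exact: Ck_openZ.
- exact: Ck_open_scalar_mx.
Qed.

(** The diffeomorphism b |-> gamma b is the space part of the four-velocity; its inverse is c |-> c
    / sqrt (1 + |c|^2). *)
Lemma unit_ball3_diffeo : exists h : 'cV[R]_3 -> 'cV[R]_3,
  diffeomorphism (unit_ball3 R) [set: 'cV[R]_3] h.
Proof.
pose g (c : 'cV[R]_3) := (Num.sqrt (1 + sqnorm c))^-1 *: c.
have p1 (c : 'cV[R]_3) : 0 < 1 + sqnorm c by have := sqnorm_ge0 c; lra.
have gh b : sqnorm b < 1 -> g (gamma b *: b) = b.
  move=> b1; rewrite /g sqnormZ scalerA -[RHS]scale1r; congr (_ *: _).
  have -> : 1 + gamma b ^+ 2 * sqnorm b = gamma b ^+ 2.
    by rewrite gamma_sqr //; field; rewrite gt_eqF // subr_gt0.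
  by rewrite sqrtr_sqr gtr0_norm ?gamma_gt0 // mulVf // gt_eqF // gamma_gt0.
have sg c : sqnorm (g c) = 1 - (1 + sqnorm c)^-1.
  by rewrite sqnormZ exprVn sqr_sqrtr ?(ltW (p1 c))//; field; rewrite gt_eqF.
have g1 c : sqnorm (g c) < 1 by rewrite sg gtrBl invr_gt0.
have hg c : gamma (g c) *: g c = c.
  rewrite /gamma sg opprB addrC subrK sqrtrV ?ltW // invrK scalerA mulfV ?scale1r //.
  by rewrite gt_eqF // sqrtr_gt0.
exists (fun b => gamma b *: b); split.
- split=> //.
  + by move=> b b' /set_mem/unit_ball3P h /set_mem/unit_ball3P h' E; rewrite -(gh b) // E gh.
  + by move=> c _; exists (g c); [exact/unit_ball3P|exact: hg].
- have oU : open [set b : 'cV[R]_3 | 0 < 1 - sqnorm b].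
    apply: open_gt0; apply: smooth_open_continuous => k.
    apply: Ck_openB; [exact: openT|exact: Ck_open_cst|].
    by apply: Ck_open_sqnorm; [exact: openT|exact: Ck_open_id].
  apply: (smooth_open_on oU (F := fun b => gamma b *: b)) => //.
    by move=> b /unit_ball3P /=; rewrite subr_gt0.
  move=> k; apply: Ck_openZ => //; last exact: Ck_open_id.
  by apply: Ck_open_gamma => // [x|]; [rewrite /= subr_gt0|exact: Ck_open_id].
- exists g; split; last by move=> b /unit_ball3P; exact: gh.
  apply: (smooth_open_on openT (F := g)) => // k.
  have oT : open [set: 'cV[R]_3] := openT.
  apply: Ck_openZ => //; last exact: Ck_open_id.
  apply: Ck_openV => // [x _|]; first by rewrite gt_eqF // sqrtr_gt0.
  apply: Ck_open_sqrt => //; apply: Ck_openD => //; first exact: Ck_open_cst.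
  by apply: Ck_open_sqnorm => //; exact: Ck_open_id.
Qed.

Lemma Ck_open_time k U : open U -> Ck_open k U (@lorentz_time R).
Proof. move=> oU; apply: Ck_open_coord => //.
rewrite (_ : @drsubmx R 3 1 3 1 = mxsub (@rshift 3 1) (@rshift 3 1)); last first.
  by apply/funext => L; exact: drsubmxEsub.
by apply: Ck_open_mxsub => //; exact: Ck_open_id. Qed.

Lemma Ck_open_ursub k U : open U ->
  Ck_open k U (fun L : 'M[R]_(3 + 1) => ursubmx L).
Proof.
move=> oU; rewrite (_ : @ursubmx R 3 1 3 1 = mxsub (@lshift 3 1) (@rshift 3 1)).
  by apply: Ck_open_mxsub => //; exact: Ck_open_id.
by apply/funext => L; exact: ursubmxEsub.
Qed.

Lemma lorentz_trivial_fibration :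
  trivial_fibration (lorentz_group R) (@velocity R) (unit_ball3 R) (O3_pm1 R).
Proof.
exists fiber; split.
- split.
  + move=> L hL /=; rewrite velocityE //.
    by split; [exact/unit_ball3P/beta_lt1|exact: O3_pm1_fiber].
  + move=> L M /set_mem hL /set_mem hM; rewrite !velocityE // => -[hb hf].
    by rewrite -(boost_fiber hL) hb hf boost_fiber.
  + move=> [b M] [/= /unit_ball3P b1 hM]; exists (boost b *m M).
      by apply: lorentzM; [exact: lorentz_boost|exact: O3_pm1_lorentz].
    rewrite velocityE ?beta_boostM ?fiber_boost //.
    by apply: lorentzM; [exact: lorentz_boost|exact: O3_pm1_lorentz].
(* D is 1 on the Lorentz group, and D > 0 ensures s <> 0 and |q / s| < 1, which is all that the
   formulas for [beta] and [fiber] require. *)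
- pose D (L : 'M[R]_(3 + 1)) := lorentz_time L ^+ 2 - sqnorm (ursubmx L).
  have oU : open [set L | 0 < D L].
    apply: open_gt0; apply: smooth_open_continuous => k.
    have oT : open [set: 'M[R]_(3 + 1)] := openT.
    apply: Ck_openB => //; last by apply: Ck_open_sqnorm => //; exact: Ck_open_ursub.
    by under eq_fun do rewrite expr2; apply: Ck_openM => //; exact: Ck_open_time.
  have D0 L : 0 < D L -> lorentz_time L != 0.
    move=> DL; apply/eqP => s0; move: DL; rewrite /D s0.
    by have := sqnorm_ge0 (ursubmx L); lra.
  apply: (smooth_open_on oU (F := fun L => (beta L, fiber L))).
  + move=> L hL /=; have [_ _ h] := lorentz_submxP hL.
    by rewrite /D h; lra.
  + by move=> L hL; rewrite velocityE.
  move=> k; have Cb : Ck_open k [set L | 0 < D L] beta.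
    apply: Ck_openZ => //; last exact: Ck_open_ursub.
    by apply: Ck_openV => //; exact: Ck_open_time.
  apply: Ck_open_pair => //; apply: Ck_open_mulmx => //; last exact: Ck_open_id.
  apply: Ck_open_mulmx => //; last exact: Ck_open_cst.
  apply: Ck_open_mulmx => //; first exact: Ck_open_cst.
  apply: Ck_open_boost => // L /= DL; have s0 := D0 _ DL.
  have s2 : 0 < lorentz_time L ^+ 2 by rewrite exprn_even_gt0.
  rewrite /beta sqnormZ exprVn mulrC ltr_pdivrMr // mul1r.
  by move: DL; rewrite /D subr_gt0.
- exists (fun p => boost p.1 *m p.2); split; last first.
    by move=> L hL /=; rewrite velocityE // boost_fiber.
  pose F (p : 'cV[R]_3 * 'M[R]_(3 + 1)) := boost p.1 *m p.2.
  have oU : open [set p : 'cV[R]_3 * 'M[R]_(3 + 1) | 0 < 1 - sqnorm p.1].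
    apply: open_gt0; apply: smooth_open_continuous => k.
    apply: Ck_openB; [exact: openT|exact: Ck_open_cst|].
    by apply: Ck_open_sqnorm; [exact: openT|exact: Ck_open_fst].
  apply: (smooth_open_on oU (F := F)) => //.
    by move=> [b M] [/= /unit_ball3P b1 _]; rewrite subr_gt0.
  move=> k; apply: Ck_open_mulmx => //; last exact: Ck_open_snd.
  by apply: Ck_open_boost => // [p|]; [rewrite /= subr_gt0|exact: Ck_open_fst].
Qed.

End fibration.

(** * Dimensions *)

Section cayley.
Context {R : realType}.
Variable n : nat.
Implicit Types (J X Y A : 'M[R]_n).

(* With this sign convention the Cayley transform is an involution. *)
Definition cayley X := (1%:M - X) *m invmx (1%:M + X).

Lemma cayleyM X : 1%:M + X \in unitmx -> cayley X *m (1%:M + X) = 1%:M - X.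
Proof. by move=> uX; rewrite /cayley mulmxKV. Qed.

(** Indeed (1 + cayley X)(1 + X) = 2. *)
Lemma cayley_unit X : 1%:M + X \in unitmx -> 1%:M + cayley X \in unitmx.
Proof.
move=> uX; have : (1%:M + cayley X) *m (2^-1 *: (1%:M + X)) = 1%:M.
  rewrite -scalemxAr mulmxDl mul1mx cayleyM // addrACA subrr addr0.
  by rewrite -mulr2n -[1%:M *+ 2]scaler_nat scalerA mulVf ?scale1r// pnatr_eq0.
by move=> /mulmx1_unit[].
Qed.

Lemma cayleyK X : 1%:M + X \in unitmx -> cayley (cayley X) = X.
Proof.
move=> uX; have uC := cayley_unit uX.
suff E : 1%:M - cayley X = X *m (1%:M + cayley X).
  by rewrite {1}/cayley E mulmxK.
(* After multiplication by 1 + X on the right, both sides are 2 X. *)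
apply: (can_inj (mulmxK uX)); rewrite mulmxBl mul1mx cayleyM //.
rewrite -mulmxA mulmxDl mul1mx cayleyM // [X in _ *m X]addrACA subrr addr0.
by rewrite mulmxDr mulmx1 opprB addrC addrA subrK.
Qed.

Lemma cayley0 : cayley 0 = 1%:M.
Proof. by rewrite /cayley subr0 addr0 invmx1 mulmx1. Qed.

(** Multiplying by (1 + X)^T and 1 + X on the two sides turns the sum into 2 (J - X^T J X). The form
    J is G for the chart of the Lorentz group and 1 for rotations. *)
Lemma cayley_skew J X : 1%:M + X \in unitmx -> X^T *m J *m X = J ->
  (cayley X)^T *m J + J *m cayley X = 0.
Proof.
move=> uX hX; have uXt : (1%:M + X)^T \in unitmx by rewrite unitmx_tr.
apply: (can_inj (mulKmx uXt)); apply: (can_inj (mulmxK uX)).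
rewrite mulmx0 mul0mx; move: (cayley X) (cayleyM uX) => c cM.
rewrite [(1%:M + X)^T *m (_ + _)]mulmxDr mulmxDl -!mulmxA cM !mulmxA -trmx_mul cM.
rewrite !(linearB, linearD) /= !trmx1.
rewrite !(mulmxDl, mulmxDr, mulmxN, mulNmx, mul1mx, mulmx1).
by rewrite hX; apply/matrixP => i j; rewrite !mxE; ring.
Qed.

(** Cleared of inverses, this is (1 - A)^T J (1 - A) = (1 + A)^T J (1 + A), whose cross terms vanish
    by hypothesis. *)
Lemma cayley_isometry J A : 1%:M + A \in unitmx -> A^T *m J + J *m A = 0 ->
  (cayley A)^T *m J *m cayley A = J.
Proof.
move=> uA hA; have uAt : (1%:M + A)^T \in unitmx by rewrite unitmx_tr.
apply: (can_inj (mulKmx uAt)); apply: (can_inj (mulmxK uA)).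
move: (cayley A) (cayleyM uA) => c cM.
rewrite -!mulmxA cM !mulmxA -trmx_mul cM.
rewrite !(linearB, linearD) /= !trmx1.
rewrite !(mulmxDl, mulmxDr, mulmxN, mulNmx, mul1mx, mulmx1).
have -> : A^T *m J = - (J *m A) by apply/eqP; rewrite -addr_eq0 hA.
by apply/matrixP => i j; rewrite !mxE; ring.
Qed.

Lemma Ck_open_cayley (V : normedModType R) k (U : set V) (f : V -> 'M[R]_n) :
  open U -> (forall x, U x -> 1%:M + f x \in unitmx) ->
  Ck_open k U f -> Ck_open k U (fun x => cayley (f x)).
Proof.
move=> oU uf cf; apply: Ck_open_mulmx => //.
  by apply: Ck_openB => //; exact: Ck_open_cst.
by apply: Ck_open_invmx => //; apply: Ck_openD => //; exact: Ck_open_cst.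
Qed.

End cayley.

(** * Charts of the Lorentz group and of products with R^n *)

Section dimension.
Context {R : realType}.

Local Notation G := (poincare_gram R).

(* Coordinates of a skew matrix: its entries above the diagonal, read column
   by column, so that the entry (i, j) has index i + j (j - 1) / 2. *)
Definition skew6 (v : 'rV[R]_6) : 'M[R]_(3 + 1) := \matrix_(i, j)
  if (i < j)%N then v 0 (inord (i + 'C(j, 2)))
  else if (j < i)%N then - v 0 (inord (j + 'C(i, 2))) else 0.

Definition unskew6 (K : 'M[R]_(3 + 1)) : 'rV[R]_6 := \row_k
  K (inord (nth 0 [:: 0; 0; 1; 0; 1; 2] k) : 'I_4)
    (inord (nth 0 [:: 1; 2; 2; 3; 3; 3] k) : 'I_4).

Lemma skew6_tr v : (skew6 v)^T = - skew6 v.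
Proof. by apply/matrixP => i j; rewrite !mxE; case: ltngtP; rewrite ?opprK ?oppr0. Qed.

Lemma skew6K : cancel skew6 unskew6.
Proof.
move=> v; apply/rowP => k; rewrite !mxE.
by case: k => -[|[|[|[|[|[|k]]]]]] hk //=; rewrite !inordK //=;
  congr (v 0 _); apply/val_inj; rewrite /= inordK.
Qed.

Lemma unskew6K K : K^T = - K -> skew6 (unskew6 K) = K.
Proof.
move=> hK.
have hK' i j : K j i = - K i j by have /matrixP/(_ i j) := hK; rewrite !mxE.
have K0 i : K i i = 0 by have := hK' i i; lra.
have H (i j : 'I_4) : (i < j)%N -> K i j = unskew6 K 0 (inord (i + 'C(j, 2))).
  case: i => -[|[|[|[|i]]]] hi //; case: j => -[|[|[|[|j]]]] hj // _;
    rewrite mxE /= inordK //=; congr (K _ _); apply/val_inj; rewrite /= inordK //.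
apply/matrixP => i j; rewrite [LHS]mxE; case: ltngtP => [ij|ji|/val_inj ->].
- by rewrite -H.
- by rewrite -H // hK' opprK.
- by rewrite K0.
Qed.

Lemma Ck_open_skew6 (V : normedModType R) k (U : set V) (f : V -> 'rV[R]_6) :
  open U -> Ck_open k U f -> Ck_open k U (fun x => skew6 (f x)).
Proof.
move=> oU cf; apply: Ck_open_mx => // i j; under eq_fun do rewrite mxE.
case: (i < j)%N; first exact: Ck_open_coord.
case: (j < i)%N; last exact: Ck_open_cst.
under eq_fun do rewrite -sub0r.
by apply: Ck_openB => //; [exact: Ck_open_cst|exact: Ck_open_coord].
Qed.

Lemma Ck_open_unskew6 (V : normedModType R) k (U : set V) (f : V -> 'M[R]_(3 + 1)) :
  open U -> Ck_open k U f -> Ck_open k U (fun x => unskew6 (f x)).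
Proof.
move=> oU cf; apply: Ck_open_mx => // i j; under eq_fun do rewrite mxE.
exact: Ck_open_coord.
Qed.

Lemma open_unitmx (V : normedModType R) n (f : V -> 'M[R]_n) :
  smooth_open setT f -> open [set x | f x \in unitmx].
Proof.
move=> sf.
rewrite (_ : [set x | _] = [set x | \det (f x) != 0]); last first.
  by apply/seteqP; split=> x /=; rewrite unitmxE unitfE.
apply: open_neq0; apply: smooth_open_continuous => k.
by apply: Ck_open_det; [exact: openT|exact: sf].
Qed.

(* The Cayley transform is a chart at the identity, and is moved to the other
   points by left translation. *)
Lemma submanifold_lorentz : submanifold 6 (lorentz_group R).
Proof.
move=> L0 hL0; have uL0 := lorentz_unit hL0; have hL0' := lorentzV hL0.
have oT (V : normedModType R) : open [set: V] := openT.
pose U := [set L : 'M[R]_(3 + 1) | 1%:M + invmx L0 *m L \in unitmx].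
pose O := [set v : 'rV[R]_6 | 1%:M + G *m skew6 v \in unitmx].
(* The Cayley transform X of a Lorentz matrix satisfies X^T G + G X = 0, so K = G X is skew, and X =
   G K is recovered from its six coordinates. *)
pose f L := unskew6 (G *m cayley (invmx L0 *m L)).
pose g v := L0 *m cayley (G *m skew6 v).
have oU : open U.
  apply: open_unitmx => k; apply: Ck_openD => //; first exact: Ck_open_cst.
  by apply: Ck_open_mulmx => //; [exact: Ck_open_cst|exact: Ck_open_id].
have oO : open O.
  apply: open_unitmx => k; apply: Ck_openD => //; first exact: Ck_open_cst.
  apply: Ck_open_mulmx => //; first exact: Ck_open_cst.
  by apply: Ck_open_skew6 => //; exact: Ck_open_id.
have skf L : (lorentz_group R `&` U) L ->
    G *m skew6 (f L) = cayley (invmx L0 *m L).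
  move=> [hL UL]; rewrite unskew6K; first by rewrite mulmxA gramK mul1mx.
  have := cayley_skew UL (lorentzM hL0' hL) => /eqP; rewrite addr_eq0 => /eqP h.
  by rewrite trmx_mul gram_tr h.
have fO L : (lorentz_group R `&` U) L -> O (f L).
  move=> SL; have [_ UL] := SL.
  by rewrite /O /= skf //; exact: cayley_unit.
have gf L : (lorentz_group R `&` U) L -> g (f L) = L.
  by move=> SL; have [_ UL] := SL; rewrite /g skf // cayleyK // mulKVmx.
have gS v : O v -> (lorentz_group R `&` U) (g v).
  move=> Ov; split.
    apply: lorentzM => //; apply: cayley_isometry => //.
    by rewrite trmx_mul gram_tr skew6_tr -mulmxA gramK mulmx1 mulmxA gramK mul1mx addNr.
  by rewrite /U /= /g mulKmx //; exact: cayley_unit.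
have fg v : O v -> f (g v) = v.
  by move=> Ov; rewrite /f /g mulKmx // cayleyK // mulmxA gramK mul1mx skew6K.
exists U, O, f; split => //.
  rewrite /U /= mulVmx // -mulr2n -[1%:M *+ 2]scaler_nat.
  by rewrite unitmxZ ?unitmx1 // unitfE pnatr_eq0.
split.
- split=> //.
  + by move=> L M /set_mem hL /set_mem hM E; rewrite -(gf _ hL) E gf.
  + by move=> v Ov; exists (g v); [exact: gS|exact: fg].
- apply: (smooth_open_on oU (F := f)) => // k.
  apply: Ck_open_unskew6 => //; apply: Ck_open_mulmx => //; first exact: Ck_open_cst.
  apply: Ck_open_cayley => //.
  by apply: Ck_open_mulmx => //; [exact: Ck_open_cst|exact: Ck_open_id].
- exists g; split => //; apply: (smooth_open_on oO (F := g)) => // k.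
  apply: Ck_open_mulmx => //; first exact: Ck_open_cst.
  apply: Ck_open_cayley => //; apply: Ck_open_mulmx => //; first exact: Ck_open_cst.
  by apply: Ck_open_skew6 => //; exact: Ck_open_id.
Qed.

Lemma setXT_preimage (T T' : Type) (U : set T) : U `*` [set: T'] = fst @^-1` U.
Proof. by apply/seteqP; split => [p []|p] //; split. Qed.

Lemma open_setXT (V W : normedModType R) (U : set V) :
  open U -> open (U `*` [set: W]).
Proof.
by move=> oU; rewrite setXT_preimage; apply: open_comp => // p _; exact: cvg_fst.
Qed.

(** A chart of S is paired with transposition on the second factor; the smooth extensions are those
    of S pulled back along the linear projections. *)
Lemma submanifold_setXT (V : normedModType R) d n (S : set V) :
  submanifold d S -> submanifold (d + n) (S `*` [set: 'cV[R]_n]).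
Proof.
move=> mS [x c] [/= Sx _]; have [U [T [f [oU Ux oT [[fT fI fS] sf [g [sg gf]]]]]]] := mS x Sx.
have SU : (S `*` setT) `&` (U `*` setT) = (S `&` U) `*` [set: 'cV[R]_n].
  by rewrite -setXI setIT.
have cfst : continuous (fst : V * 'cV[R]_n -> V) by move=> p; exact: cvg_fst.
have clsub : continuous (lsubmx : 'rV[R]_(d + n) -> 'rV[R]_d).
  exact: linear_mx_continuous.
exists (U `*` setT), [set w : 'rV[R]_(d + n) | T (lsubmx w)].
exists (fun p => row_mx (f p.1) p.2^T); rewrite SU; split => //.
- exact: open_setXT.
- by apply: open_comp => // w _; exact: clsub.
split.
- split.
  + by move=> [y e] [/= Sy _]; rewrite row_mxKl; exact: fT.
  + move=> [y e] [z e'] /set_mem[/= Sy _] /set_mem[/= Sz _].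
    by move=> /eq_row_mx[/fI E /trmx_inj ->]; rewrite (E (mem_set Sy) (mem_set Sz)).
  + move=> w /= /fS[y Sy fy]; exists (y, (rsubmx w)^T) => //=.
    by rewrite fy trmxK hsubmxK.
- move=> [y e] [/= Sy _]; have [U' [F [oU' U'y sF Ff]]] := sf y Sy.
  have oUT : open (U' `*` [set: 'cV[R]_n]) by exact: open_setXT.
  exists (U' `*` setT), (fun p => row_mx (F p.1) p.2^T); split => //.
    move=> k; apply: Ck_open_mx => // i j; case: (split_ordP j) => {}j ->.
      under eq_fun do rewrite row_mxEl; apply: Ck_open_coord => //.
      rewrite setXT_preimage.
      exact: Ck_open_comp_linear.
    under eq_fun do rewrite row_mxEr mxE; apply: Ck_open_coord => //.
    exact: Ck_open_snd.
  by move=> [z e'] [/= Sz _] [/= U'z _]; rewrite Ff.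
- exists (fun w => (g (lsubmx w), (rsubmx w)^T)); split; last first.
    by move=> [y e] [/= Sy _]; rewrite row_mxKl row_mxKr trmxK gf.
  move=> w /= Ow; have [U' [F [oU' U'y sF Fg]]] := sg _ Ow.
  have oU'l : open (lsubmx @^-1` U' : set 'rV[R]_(d + n)).
    by apply: open_comp => // z _; exact: clsub.
  exists (lsubmx @^-1` U'), (fun w => (F (lsubmx w), (rsubmx w)^T)); split => //.
    move=> k; apply: Ck_open_pair => //; first exact: Ck_open_comp_linear.
    by apply: Ck_open_tr => //; exact: Ck_open_linear_mx.
  by move=> z Oz U'z; rewrite Fg.
Qed.

End dimension.

(** * Connected components *)

Section rotations.
Context {R : realType}.
Implicit Types M : 'M[R]_3.

Lemma det_mx22 (B : 'M[R]_2) : \det B = B 0 0 * B 1 1 - B 0 1 * B 1 0.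
Proof.
rewrite (expand_det_row _ ord0) !big_ord_recl big_ord0 /cofactor !det_mx11 !mxE.
have -> : lift ord0 ord0 = 1 :> 'I_2 by apply/val_inj.
have -> : lift 1 0 = 0 :> 'I_2 by apply/val_inj.
by rewrite /= expr0 expr1 mul1r addr0 mulN1r mulrN.
Qed.

Lemma bump3E : (bump 0 0 = 1%N) * (bump 0 1 = 2%N) * (bump 1 0 = 0%N) *
  (bump 1 1 = 2%N) * (bump 2 0 = 0%N) * (bump 2 1 = 1%N) * (1 %% 2 = 1)%N.
Proof. by []. Qed.

(** Entries indexed by natural numbers let the lifted indices of the expansion reduce by
    [bump3E]. *)
Lemma det_mx33 (f : nat -> nat -> R) :
  \det (\matrix_(i < 3, j < 3) f i j) =
    f 0%N 0%N * (f 1%N 1%N * f 2%N 2%N - f 1%N 2%N * f 2%N 1%N)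
  - f 0%N 1%N * (f 1%N 0%N * f 2%N 2%N - f 1%N 2%N * f 2%N 0%N)
  + f 0%N 2%N * (f 1%N 0%N * f 2%N 1%N - f 1%N 1%N * f 2%N 0%N).
Proof.
rewrite (expand_det_row _ ord0) !big_ord_recl big_ord0 /cofactor !det_mx22 !mxE.
by rewrite /= !bump3E; ring.
Qed.

Lemma mxtrace33 M : \tr M = M 0 0 + M 1 1 + M 2 2.
Proof.
rewrite /mxtrace !big_ord_recl big_ord0 addr0 addrA.
by congr (_ + M _ _ + M _ _); apply/val_inj.
Qed.

Lemma adj_SO3 M : M^T *m M = 1%:M -> \det M = 1 -> \adj M = M^T.
Proof.
move=> /mulmx1C hM dM.
by rewrite -[LHS]mulmx1 -hM mulmxA mul_adj_mx dM mul1mx.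
Qed.

(** The determinant of 1 + M is 1 + tr M + m + det M, where m is the sum of the principal 2 x 2
    minors. These are the diagonal entries of [\adj M] = M^T, so m = tr M. *)
Lemma det_1D_SO3 M : M^T *m M = 1%:M -> \det M = 1 ->
  \det (1%:M + M) = 2 * (1 + \tr M).
Proof.
move=> hM dM; have adjM := adj_SO3 hM dM.
pose f (i j : nat) : R := M (inord i) (inord j).
have ME : M = \matrix_(i < 3, j < 3) f i j.
  by apply/matrixP => i j; rewrite mxE /f !inord_val.
have cE k : cofactor M k k = M k k.
  by have /matrixP/(_ k k) := adjM; rewrite !mxE.
have c0 := cE 0; have c1 := cE 1; have c2 := cE 2.
rewrite ME /cofactor !det_mx22 !mxE /= !bump3E in c0 c1 c2.
have -> : 1%:M + M = \matrix_(i < 3, j < 3) ((i == j :> nat)%:R + f i j).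
  by apply/matrixP => i j; rewrite !mxE /f !inord_val.
rewrite (det_mx33 (fun i j => (i == j)%:R + f i j)) /=.
rewrite mxtrace33 ME !mxE /=.
have := dM; rewrite ME det_mx33 => dM'.
transitivity (1 + (f 0%N 0%N + f 1%N 1%N + f 2%N 2%N)
    + ((f 1%N 1%N * f 2%N 2%N - f 1%N 2%N * f 2%N 1%N)
     + (f 0%N 0%N * f 2%N 2%N - f 0%N 2%N * f 2%N 0%N)
     + (f 0%N 0%N * f 1%N 1%N - f 0%N 1%N * f 1%N 0%N)) + 1).
  by rewrite -[X in _ = _ + X]dM'; ring.
have e0 : f 1%N 1%N * f 2%N 2%N - f 1%N 2%N * f 2%N 1%N = f 0%N 0%N by rewrite -[RHS]c0; ring.
have e1 : f 0%N 0%N * f 2%N 2%N - f 0%N 2%N * f 2%N 0%N = f 1%N 1%N by rewrite -[RHS]c1; ring.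
have e2 : f 0%N 0%N * f 1%N 1%N - f 0%N 1%N * f 1%N 0%N = f 2%N 2%N by rewrite -[RHS]c2; ring.
by rewrite e0 e1 e2; ring.
Qed.


(* A signed cyclic permutation matrix, of determinant 1 and of trace 0 when
   s and t are signs. *)
Definition scyc_coef (s t : R) (i j : nat) : R :=
  nth 0 (nth [::] [:: [:: 0; s; 0]; [:: 0; 0; t]; [:: s * t; 0; 0]] i) j.

Definition scyc (s t : R) : 'M[R]_3 := \matrix_(i < 3, j < 3) scyc_coef s t i j.

Lemma scyc_orth s t : s ^+ 2 = 1 -> t ^+ 2 = 1 -> (scyc s t)^T *m scyc s t = 1%:M.
Proof.
move=> s2 t2; apply/matrixP => i j; rewrite !mxE !big_ord_recl big_ord0 !mxE /scyc_coef /=.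
by case: i => -[|[|[|i]]] hi //; case: j => -[|[|[|j]]] hj //=;
  rewrite ?mul0r ?mulr0 ?addr0 ?add0r //= -?expr2 ?exprMn ?s2 ?t2 ?mulr1.
Qed.

Lemma det_scyc s t : s ^+ 2 = 1 -> t ^+ 2 = 1 -> \det (scyc s t) = 1.
Proof.
move=> s2 t2; rewrite det_mx33 /scyc_coef /=.
by transitivity (s ^+ 2 * t ^+ 2); [ring|rewrite s2 t2 mulr1].
Qed.

Lemma tr_scyc s t : \tr (scyc s t) = 0.
Proof. by rewrite mxtrace33 !mxE /scyc_coef /= !addr0. Qed.

Lemma tr_scycM s t M : \tr (scyc s t *m M) = s * M 1 0 + t * M 2 1 + s * t * M 0 2.
Proof.
rewrite mxtrace33 !mxE !big_ord_recl !big_ord0 !mxE /scyc_coef /= !(mul0r, add0r, addr0).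
have -> : lift ord0 ord0 = 1 :> 'I_3 by apply/val_inj.
by have -> : lift ord0 (lift ord0 ord0) = 2 :> 'I_3 by apply/val_inj.
Qed.

(** The four traces add up to 0, since s, t and s t each sum to 0 over the choices of signs; they
    cannot all be negative. *)
Lemma scyc_tr_ge0 M : exists s t,
  [/\ s ^+ 2 = 1, t ^+ 2 = 1 & 0 <= \tr (scyc s t *m M)].
Proof.
have N1 : (-1) ^+ 2 = 1 :> R by rewrite sqrrN expr1n.
have [h|h] := lerP 0 (\tr (scyc 1 1 *m M)).
  by exists 1, 1; rewrite expr1n.
have [h'|h'] := lerP 0 (\tr (scyc 1 (-1) *m M)).
  by exists 1, (-1); rewrite expr1n N1.
have [h''|h''] := lerP 0 (\tr (scyc (-1) 1 *m M)).
  by exists (-1), 1; rewrite expr1n N1.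
exists (-1), (-1); rewrite N1; split=> //.
by move: h h' h''; rewrite !tr_scycM; lra.
Qed.

End rotations.

(** * Components under continuous maps, along paths, and their count *)

Section connected_components.

Lemma connected_component_image (T T' : topologicalType) (f : T -> T')
    (S : set T) (S' : set T') x y : continuous f -> f @` S `<=` S' ->
  connected_component S x y -> connected_component S' (f x) (f y).
Proof.
move=> cf fS [C [Cx CS cC] Cy]; exists (f @` C); last by exists y.
split; first by exists x.
  by apply: subset_trans fS; exact: image_subset.
by apply: connected_continuous_connected => //; exact: continuous_subspaceT.
Qed.

Lemma path_connected_component (R : realType) (T : topologicalType) (S : set T)
    (f : R -> T) :
  (forall t, 0 <= t <= 1 -> {for t, continuous f}) ->
  (forall t, 0 <= t <= 1 -> S (f t)) ->
  connected_component S (f 0) (f 1).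
Proof.
move=> cf fS; exists (f @` `[0, 1]); last first.
  by exists 1 => //=; rewrite in_itv /= ler01 lexx.
split.
- by exists 0 => //=; rewrite in_itv /= ler01 lexx.
- by move=> _ [t /= ht <-]; apply: fS; rewrite in_itv in ht.
- apply: connected_continuous_connected; first exact: segment_connected.
  apply: continuous_in_subspaceT => t /set_mem /= ht; apply: cf.
  by rewrite in_itv in ht.
Qed.

(** The image of a connected subset of S is an interval that avoids 0. *)
Lemma connected_component_gt0 (R : realType) (T : topologicalType) (S : set T)
    (f : T -> R) x y : continuous f -> (forall z, S z -> f z != 0) ->
  connected_component S x y -> (0 < f x) = (0 < f y).
Proof.
move=> cf f0 [C [Cx CS cC] Cy].
have cI : is_interval (f @` C).
  apply/connected_intervalP/connected_continuous_connected => //.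
  exact: continuous_subspaceT.
have fC0 : ~ (f @` C) 0 by move=> [z /CS/f0 /eqP].
have fCx : (f @` C) (f x) by exists x.
have fCy : (f @` C) (f y) by exists y.
case: (ltrP 0 (f x)) => hx; case: (ltrP 0 (f y)) => hy //; exfalso; apply: fC0.
  by apply: (cI _ _ fCy fCx); rewrite hy ltW.
by apply: (cI _ _ fCx fCy); rewrite hx ltW.
Qed.

Lemma components_card (T : topologicalType) (S : set T) (n : nat) (e : nat -> T) :
  (forall i, S (e i)) ->
  (forall x, S x -> exists2 i, (i < n)%N & connected_component S (e i) x) ->
  (forall i j, (i < n)%N -> (j < n)%N -> connected_component S (e i) (e j) -> i = j) ->
  (components S #= `I_n)%card.
Proof.
move=> Se cover sep.
have -> : components S = (fun i => connected_component S (e i)) @` `I_n.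
  apply/seteqP; split=> [_ [x Sx <-]|_ [i _ <-]]; last by exists (e i).
  have [i ni ix] := cover x Sx; exists i => //; exact: same_connected_component.
apply: inj_card_eq => i j /set_mem ni /set_mem nj E; apply: sep => //.
by have := connected_component_refl (Se j); rewrite -E.
Qed.

End connected_components.

(** * The four components of the Lorentz and Poincare groups *)

Section lorentz_components.
Context {R : realType}.
Implicit Types (A : 'M[R]_3) (L : 'M[R]_(3 + 1)).

Let O3 : set 'M[R]_3 := [set A | A^T *m A = 1%:M].

(** If u (1 + K) = 0 then u u^T = - u K u^T, and u K u^T is zero as a skew 1 x 1 matrix; hence u =
    0. *)
Lemma skew_unit n (K : 'M[R]_n) : K^T = - K -> 1%:M + K \in unitmx.
Proof.
move=> hK; rewrite -row_free_unit -kermx_eq0; apply/eqP/row_matrixP => i.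
rewrite row0; set u := row i _.
have uK : u *m (1%:M + K) = 0.
  by rewrite /u -row_mul mulmx_ker row0.
have uKu : u *m K *m u^T = 0.
  apply/matrixP => a b; rewrite !ord1 [RHS]mxE.
  have : (u *m K *m u^T)^T = - (u *m K *m u^T).
    by rewrite !trmx_mul trmxK hK mulNmx mulmxN mulmxA.
  by move=> /matrixP/(_ 0 0); rewrite mxE [RHS]mxE; lra.
have : (u^T)^T *m u^T = 0.
  move: uK; rewrite mulmxDr mulmx1 => /(congr1 (mulmx^~ u^T)).
  by rewrite mulmxDl uKu addr0 mul0mx trmxK.
rewrite mul_trmx_col => /matrixP/(_ 0 0); rewrite !mxE eqxx mulr1n => /sqnorm_eq0.
by move=> /(congr1 trmx); rewrite trmxK trmx0.
Qed.

(** The matrix [cayley A] is skew, and so are its multiples, so [skew_unit] keeps the path t |->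
    cayley (t cayley A) defined and inside O(3). *)
Lemma O3_component_cayley A : O3 A -> 1%:M + A \in unitmx ->
  connected_component O3 1%:M A.
Proof.
move=> hA uA; have hA1 : A^T *m 1%:M *m A = 1%:M by rewrite mulmx1.
have := cayley_skew uA hA1; rewrite mulmx1 mul1mx => /eqP.
rewrite addr_eq0 => /eqP Kt.
have tKt (t : R) : (t *: cayley A)^T = - (t *: cayley A).
  by rewrite linearZ /= Kt scalerN.
have uK t := skew_unit (tKt t).
have := @path_connected_component R _ O3 (fun t => cayley (t *: cayley A)).
rewrite scale0r cayley0 scale1r cayleyK //; apply=> t _.
  apply: smooth_open_continuous => k; apply: Ck_open_cayley => //; first exact: openT.
  by apply: Ck_open_scale; [exact: openT|exact: Ck_open_id].
have tK1 : (t *: cayley A)^T *m 1%:M + 1%:M *m (t *: cayley A) = 0.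
  by rewrite mulmx1 mul1mx tKt addNr.
by rewrite /O3 /=; have := cayley_isometry (uK t) tK1; rewrite mulmx1.
Qed.

Lemma SO3_component_tr_ge0 A : O3 A -> \det A = 1 -> 0 <= \tr A ->
  connected_component O3 1%:M A.
Proof.
move=> hA dA tA; apply: O3_component_cayley => //.
by rewrite unitmxE unitfE det_1D_SO3 // gt_eqF //; lra.
Qed.

Lemma mulmx_continuous m n p (B : 'M[R]_(m, n)) :
  continuous (mulmx B : 'M[R]_(n, p) -> 'M[R]_(m, p)).
Proof. exact: linear_mx_continuous. Qed.

(** Left translation by Q^T carries the connection from 1 to Q A into one from Q^T to A, and Q^T, of
    trace 0, is itself joined to 1. *)
Lemma SO3_component A : O3 A -> \det A = 1 -> connected_component O3 1%:M A.
Proof.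
move=> hA dA; have [s [t [s2 t2 trQ]]] := scyc_tr_ge0 A.
have hQ := scyc_orth s2 t2; have dQ := det_scyc s2 t2.
set Q := scyc s t in hQ dQ trQ.
have hQA : O3 (Q *m A) by rewrite /O3 /= trmx_mul mulmxA -(mulmxA _ Q^T) hQ mulmx1.
have QtQ : connected_component O3 Q^T A.
  rewrite -[A in X in _ X]mul1mx -hQ -mulmxA -[Q^T in X in _ X _]mulmx1.
  apply: (connected_component_image (f := mulmx Q^T) (S := O3)).
  - exact: mulmx_continuous.
  - move=> _ [B hB <-]; rewrite /O3 /= trmx_mul trmxK mulmxA -(mulmxA _ Q).
    by rewrite (mulmx1C hQ) mulmx1.
  - by apply: SO3_component_tr_ge0 => //; rewrite det_mulmx dQ dA mulr1.
apply: connected_component_trans QtQ; apply: SO3_component_tr_ge0.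
- by rewrite /O3 /= trmxK; exact: mulmx1C.
- by rewrite det_tr.
- by rewrite mxtrace_tr tr_scyc.
Qed.

Lemma lorentz_fiber_component L : lorentz_group R L ->
  connected_component (lorentz_group R) (fiber L) L.
Proof.
move=> hL; have b1 := beta_lt1 hL; have hF := O3_pm1_fiber hL.
pose f (t : R) := boost (t *: beta L) *m fiber L.
have tb1 (t : R) : 0 <= t <= 1 -> sqnorm (t *: beta L) < 1.
  move=> /andP[t0 t1]; rewrite sqnormZ; apply: le_lt_trans b1.
  by rewrite ler_piMl ?sqnorm_ge0 // expr_le1.
have f0 : f 0 = fiber L.
  rewrite /f scale0r -[RHS]mul1mx; congr (_ *m _).
  by rewrite /boost trmx0 mulmx0 !scaler0 addr0 /gamma /sqnorm big1 ?subr0 ?sqrtr1 ?invr1 -?scalar_mx_block // => i _; rewrite mxE expr0n.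
have f1 : f 1 = L by rewrite /f scale1r boost_fiber.
rewrite -[in X in _ X L]f0 -[X in _ _ X]f1.
apply: path_connected_component => t ht; last first.
  by apply: lorentzM; [apply: lorentz_boost; exact: tb1|exact: O3_pm1_lorentz].
have oU : open [set t : R | 0 < 1 - sqnorm (t *: beta L)].
  apply: open_gt0; apply: smooth_open_continuous => k.
  apply: Ck_openB; [exact: openT|exact: Ck_open_cst|].
  apply: Ck_open_sqnorm; first exact: openT.
  by apply: Ck_open_scale; [exact: openT|exact: Ck_open_id].
suff : smooth_open [set t : R | 0 < 1 - sqnorm (t *: beta L)] f.
  by move=> /(_ 0) /Ck_open_continuous; apply; rewrite /= subr_gt0 tb1.
move=> k.
apply: Ck_open_mulmx => //; last exact: Ck_open_cst.
apply: Ck_open_boost => // [x|]; first by rewrite /= subr_gt0.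
by apply: Ck_open_scale => //; exact: Ck_open_id.
Qed.

(** In odd dimension 3 the space block -1 has determinant -1, so the four choices of signs represent
    the four components. *)
Definition lorentz_sign (s t : R) : 'M[R]_(3 + 1) := block_mx s%:M 0 0 t%:M.

Lemma lorentz_sign_lorentz s t : s ^+ 2 = 1 -> t ^+ 2 = 1 ->
  lorentz_group R (lorentz_sign s t).
Proof.
move=> s2 t2; apply/lorentz_blockP.
rewrite tr_scalar_mx -scalar_mxM -expr2 s2 trmx0 !mulmx0 scaler0 subr0 t2 subrr.
by split=> //; rewrite /sqnorm big1 // => i _; rewrite mxE expr0n.
Qed.

Lemma O3Z s A : s ^+ 2 = 1 -> O3 A -> O3 (s *: A).
Proof.
move=> s2 hA; rewrite /O3 /= [(s *: A)^T]linearZ /= -scalemxAl -scalemxAr.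
by rewrite scalerA -expr2 s2 scale1r.
Qed.

Lemma det_O3 A : O3 A -> \det A ^+ 2 = 1.
Proof. by move=> /(congr1 determinant); rewrite det_mulmx det_tr det1 -expr2. Qed.

Lemma lorentz_sign_component L : lorentz_group R L -> exists s t,
  [/\ s = 1 \/ s = -1, t = 1 \/ t = -1 &
      connected_component (lorentz_group R) (lorentz_sign s t) L].
Proof.
move=> hL; have := lorentz_fiber_component hL.
have [A [e [hA he ->]]] := O3_pm1_fiber hL.
have d2 := det_O3 hA; set s := \det A in d2.
have hs : s = 1 \/ s = -1.
  have : s ^+ 2 == 1 ^+ 2 by rewrite d2 expr1n.
  by rewrite eqf_sqr => /orP[] /eqP ->; [left|right].
have e2 : e ^+ 2 = 1 by case: he => ->; rewrite ?sqrrN expr1n.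
move=> cL; exists s, e; split=> //; apply: connected_component_trans cL.
(* With s = det A, the matrix s A has determinant s^4 = 1 and is joined to 1 in O(3); f maps 1 to
   [lorentz_sign s e] and s A back to the block matrix of A and e. *)
pose f (B : 'M[R]_3) : 'M[R]_(3 + 1) := block_mx (s *: B) 0 0 e%:M.
have hsA : O3 (s *: A).
  exact: O3Z.
have -> : block_mx A 0 0 e%:M = f (s *: A).
  by rewrite /f scalerA -expr2 d2 scale1r.
have -> : lorentz_sign s e = f 1%:M by rewrite /f scalemx1.
apply: (connected_component_image (S := O3)).
- apply: smooth_open_continuous => k; have oT : open [set: 'M[R]_3] := openT.
  apply: Ck_open_block => //; try exact: Ck_open_cst.
  by apply: Ck_openZ => //; [exact: Ck_open_cst|exact: Ck_open_id].
- move=> _ [B hB <-]; apply: O3_pm1_lorentz; exists (s *: B), e; split => //.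
  exact: O3Z.
- apply: SO3_component => //.
  by rewrite detZ exprS d2 mulr1 -/s -expr2.
Qed.

(** The two binary digits of i < 4 encode the two signs. *)
Definition sign_rep (i : nat) := lorentz_sign ((-1) ^+ i) ((-1) ^+ i./2).

Lemma sign_rep_lorentz i : lorentz_group R (sign_rep i).
Proof. by apply: lorentz_sign_lorentz; rewrite sqrr_sign. Qed.

Lemma sign_rep_cover L : lorentz_group R L -> exists2 i, (i < 4)%N &
  connected_component (lorentz_group R) (sign_rep i) L.
Proof.
move=> /lorentz_sign_component[s [t [hs ht]]].
have N1 : (-1) ^+ 3 = -1 :> R by rewrite -signr_odd.
case: hs => ->; case: ht => -> c; [exists 0%N|exists 2%N|exists 1%N|exists 3%N] => //;
  by rewrite /sign_rep /= ?N1 ?expr0 ?expr1 ?sqrrN ?expr1n.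
Qed.

Lemma det_lorentz_sign s t : \det (lorentz_sign s t) = s ^+ 3 * t.
Proof. by rewrite det_ublock !det_scalar expr1. Qed.

Lemma time_lorentz_sign s t : lorentz_time (lorentz_sign s t) = t.
Proof. by rewrite /lorentz_time block_mxKdr mxE eqxx mulr1n. Qed.

Lemma det_lorentz_neq0 L : lorentz_group R L -> \det L != 0.
Proof. by move=> /lorentz_unit; rewrite unitmxE unitfE. Qed.

(** The determinant s^3 t has the sign of s t and the time entry is t, so together they determine
    both signs. *)
Lemma sign_rep_inj i j : (i < 4)%N -> (j < 4)%N ->
  (0 < \det (sign_rep i)) = (0 < \det (sign_rep j)) ->
  (0 < lorentz_time (sign_rep i)) = (0 < lorentz_time (sign_rep j)) -> i = j.
Proof.
have sgn k : (0 < (-1) ^+ k :> R) = ~~ odd k.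
  by rewrite -signr_odd; case: odd; rewrite ?expr0 ?expr1 ?ltr01 ?oppr_gt0 ?ltr10.
rewrite !det_lorentz_sign !time_lorentz_sign -!exprM -!exprD !sgn.
by case: i => [|[|[|[|i]]]] //; case: j => [|[|[|[|j]]]].
Qed.

Lemma det_continuous n : continuous (fun A : 'M[R]_n => \det A).
Proof.
apply: smooth_open_continuous => k.
by apply: Ck_open_det; [exact: openT|exact: Ck_open_id].
Qed.

Lemma time_continuous : continuous (@lorentz_time R).
Proof.
by apply: smooth_open_continuous => k; apply: Ck_open_time; exact: openT.
Qed.

Lemma lorentz_components : (components (lorentz_group R) #= `I_4)%card.
Proof.
apply: (components_card sign_rep_lorentz sign_rep_cover) => i j hi hj c.
apply: sign_rep_inj => //.
  by apply: connected_component_gt0 c => [|L]; [exact: det_continuous|exact: det_lorentz_neq0].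
by apply: connected_component_gt0 c => [|L]; [exact: time_continuous|exact: lorentz_time_neq0].
Qed.

Lemma poincare_components : (components (poincare_group R) #= `I_4)%card.
Proof.
rewrite poincare_groupE.
apply: (components_card (e := fun i => (sign_rep i, 0 : spacetime R))).
- by move=> i; split=> //; exact: sign_rep_lorentz.
- move=> [L C] [/= hL _]; have [i i4 iL] := sign_rep_cover hL; exists i => //.
  (* The Lorentz part is moved first, with zero translation; the segment t |-> t C then reaches
     C. *)
  apply: (connected_component_trans (y := (L, 0 : spacetime R))).
    apply: (connected_component_image (f := fun M => (M, 0 : spacetime R))) iL.
      apply: smooth_open_continuous => k.
      by apply: Ck_open_pair; [exact: openT|exact: Ck_open_id|exact: Ck_open_cst].
    by move=> _ [M hM <-].
  have := @path_connected_component R _ (lorentz_group R `*` [set: spacetime R])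
    (fun t => (L, t *: C)).
  rewrite scale0r scale1r; apply => // t _.
  apply: smooth_open_continuous => k.
  apply: Ck_open_pair; [exact: openT|exact: Ck_open_cst|].
  by apply: Ck_open_scale; [exact: openT|exact: Ck_open_id].
- move=> i j hi hj.
  (* The projection to the linear part reduces separation to the Lorentz group. *)
  move=> /(connected_component_image (f := fst) (S' := lorentz_group R)) c.
  have {}c : connected_component (lorentz_group R) (sign_rep i) (sign_rep j).
    by apply: c; [move=> p; exact: cvg_fst|move=> _ [p [/= hp _] <-]].
  apply: sign_rep_inj => //.
    by apply: connected_component_gt0 c => [|M]; [exact: det_continuous|exact: det_lorentz_neq0].
  by apply: connected_component_gt0 c => [|M]; [exact: time_continuous|exact: lorentz_time_neq0].
Qed.

End lorentz_components.

Theorem mainTheorem5 (R : realType) :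
  (* the inertial automorphisms are the maps X |-> L X + C, L Lorentz *)
  (forall g : spacetime R -> spacetime R,
     inertial_automorphism g <->
     exists (L : 'M[R]_(3 + 1)) (C : spacetime R),
       [/\ L \in unitmx, lorentz_group R L & forall X, g X = L *m X + C]) /\
  (* unique decomposition of the elements of the Lorentz group *)
  (forall L : 'M[R]_(3 + 1), lorentz_group R L ->
     exists! d : 'M[R]_3 * 'cV[R]_3 * R,
       lorentz_decomposition L d.1.1 d.1.2 d.2) /\
  (* L |-> beta is a trivial fibration over a copy of R^3, the open unit ball,
     with fiber (over 0) the subgroup O(3) x {+1, -1} *)
  [/\ trivial_fibration (lorentz_group R) (@velocity R) (unit_ball3 R)
        (O3_pm1 R),
      [set L | lorentz_group R L /\ velocity L = 0] = O3_pm1 R &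
      exists h : 'cV[R]_3 -> 'cV[R]_3,
        diffeomorphism (unit_ball3 R) [set: 'cV[R]_3] h] /\
  (* the inertial automorphisms form a group *)
  [/\ inertial_automorphism (@id (spacetime R)),
      forall g1 g2 : spacetime R -> spacetime R,
        inertial_automorphism g1 -> inertial_automorphism g2 ->
        inertial_automorphism (g1 \o g2) &
      forall g : spacetime R -> spacetime R, inertial_automorphism g ->
        exists g' : spacetime R -> spacetime R,
          [/\ inertial_automorphism g', cancel g g' & cancel g' g]] /\
  (* dimensions: 6 for the Lorentz group, hence 6 + 4 with the translations *)
  (submanifold 6 (lorentz_group R) /\
   submanifold (6 + 4) (poincare_group R)) /\
  (* four connected components *)
  ((components (lorentz_group R) #= `I_4)%card /\
   (components (poincare_group R) #= `I_4)%card).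
Proof.
split; first exact: inertialP.
split; first exact: lorentz_decomposition_unique.
split.
  split; [exact: lorentz_trivial_fibration|exact: velocity0_O3_pm1|].
  exact: unit_ball3_diffeo.
split; first by split; [exact: inertial_id|exact: inertial_comp|exact: inertial_inv].
split; last by split; [exact: lorentz_components|exact: poincare_components].
split; first exact: submanifold_lorentz.
rewrite poincare_groupE; apply: (@submanifold_setXT _ _ 6 (3 + 1)).
exact: submanifold_lorentz.
Qed.
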